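(* Let $\mathcal{H}$ be a separable complex Hilbert space, let $2\leq p\leq\infty$, and let $T\in\mathfrak{C}_p(\mathcal{H})$. Let $f,g$ be non-negative continuous functions on $[0,\infty)$ such that $f(x)g(x)=x$ for all $x\geq 0$, and let $\widetilde{T}_{f,g}=f(|T|)Ug(|T|)$ be the $(f,g)$-Aluthge transform of $T$, where $T=U|T|$ is the polar decomposition of $T$. Then $$w_p^2(T)\leq \frac14\left(\big\|g(|T|)\,\widetilde{T}_{f,g}\,f(|T|)\big\|_{\frac p2}+\big\|f(|T|)\,(\widetilde{T}_{f,g})^*\,g(|T|)\big\|_{\frac p2}+\big\|T^*T+TT^*\big\|_{\frac p2}\right).$$
   Context: $\mathfrak{L}(\mathcal{H})$ is the space of bounded linear operators on $\mathcal{H}$, and $|T|=(T^*T)^{1/2}$. The polar decomposition $T=U|T|$ is the canonical one, with $U$ the partial isometry satisfying $\ker U=\ker T$. For $1\leq p<\infty$, the Schatten class $\mathfrak{C}_p(\mathcal{H})$ is the set of compact operators $T$ on $\mathcal{H}$ with $\operatorname{tr}(|T|^p)=\sum_j s_j(T)^p<\infty$ ($s_j$ the singular values), and $\|T\|_p=(\operatorname{tr}|T|^p)^{1/p}$. For $p=\infty$, $\|\cdot\|_\infty$ is the usual operator norm, $\mathfrak{C}_\infty(\mathcal{H})$ is read as $\mathfrak{L}(\mathcal{H})$, and $\frac p2$ is read as $\infty$. The $p$-numerical radius is $w_p(T)=\sup_{\theta\in\mathbb{R}}\|\Re(e^{i\theta}T)\|_p$, where $\Re(X)=\frac{X+X^*}{2}$,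 and $w_p^2(T)=(w_p(T))^2$. Functions of the positive operator $|T|$ are defined by continuous functional calculus. *)

(* Defs.v *)
From HB Require Import structures.
From mathcomp Require Import all_boot all_order all_algebra.
From mathcomp Require Import complex.
From mathcomp Require Import all_classical all_reals all_analysis.

Set Implicit Arguments.
Unset Strict Implicit.
Unset Printing Implicit Defensive.

Import Order.TTheory GRing.Theory Num.Theory.
Import numFieldNormedType.Exports.

Local Open Scope classical_set_scope.
Local Open Scope complex_scope.
Local Open Scope ring_scope.

(* The inner product is linear in its first argument and conjugate-linear in
   its second one.  Norms of vectors take their (real) values in R[i]. *)
HB.mixin Record CompleteNormedModule_isHilbert (R : realType) H
    & @CompleteNormedModule R[i] H := {
  hdot : {dot H for Num.conj} ;
  hdot_norm : forall x : H, hdot x x = `|x| ^+ 2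
}.

#[short(type="hilbertType")]
HB.structure Definition Hilbert (R : realType) :=
  {H of CompleteNormedModule_isHilbert R H & @CompleteNormedModule R[i] H}.

Arguments hdot {R s}.

Section Operators.
Context {R : realType} {H : hilbertType R}.
Implicit Types (T A B U : H -> H) (E : set H).

Definition separable_hilbert : Prop :=
  exists2 D : set H, countable D & dense D.

Definition bounded_op T : Prop := linear T /\ continuous T.

Definition opnorm T : \bar R :=
  ereal_sup [set (complex.Re `|T x|)%:E | x in [set x : H | `|x| <= 1]].

Definition compact_op T : Prop :=
  bounded_op T /\ compact (closure (T @` [set x : H | `|x| <= 1])).

(* The objects below which are determined by a characteristic property are
   obtained by [xget], which returns its first argument if no object has the
   property. *)
Definition adjoint T : H -> H :=
  xget (fun=> 0) [set B | bounded_op B /\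
                          forall x y, hdot (T x) y = hdot x (B y)].

Definition positive_op A : Prop :=
  bounded_op A /\ forall x, 0 <= hdot (A x) x.

Definition sqrt_op A : H -> H :=
  xget (fun=> 0) [set B | positive_op B /\ B \o B = A].

Definition abs_op T : H -> H := sqrt_op (adjoint T \o T).

Definition ker_op T : set H := [set x | T x = 0].

Definition partial_isometry U : Prop :=
  bounded_op U /\
  forall x, (forall y, ker_op U y -> hdot x y = 0) -> `|U x| = `|x|.

Definition polar_op T : H -> H :=
  xget (fun=> 0) [set U | [/\ partial_isometry U, T = U \o abs_op T &
                              ker_op U = ker_op T]].

Definition spectrum A : set R[i] :=
  [set z | ~ exists B, [/\ bounded_op B,
                           forall x, B (A x - z *: x) = x &
                           forall x, A (B x) - z *: B x = x]].

Definition poly_op (q : {poly R}) A : H -> H :=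
  fun x => \sum_(i < size q) (q`_i)%:C *: iter i A x.

(* Continuous functional calculus for a self-adjoint operator A and a real
   function phi continuous on the spectrum of A (which is real): phi(A) is the
   limit in operator norm of q_n(A), for polynomials q_n converging to phi
   uniformly on the spectrum. *)
Definition is_cfc (phi : R -> R) A B : Prop :=
  bounded_op B /\
  exists q : nat -> {poly R},
    {uniform [set t : R | spectrum A t%:C],
       (fun n t => (q n).[t]) @ \oo --> phi} /\
    (fun n => opnorm (poly_op (q n) A \- B)) @ \oo --> 0%E.

Definition cfc (phi : R -> R) A : H -> H := xget (fun=> 0) (is_cfc phi A).

Definition orthonormal_basis E : Prop :=
  [/\ forall e, E e -> `|e| = 1,
      forall e e', E e -> E e' -> e <> e' -> hdot e e' = 0 &
      forall x, (forall e, E e -> hdot x e = 0) -> x = 0].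

(* Trace of a positive operator; it does not depend on the basis. *)
Definition trace_op A : \bar R :=
  \esum_(e in xget set0 orthonormal_basis) (complex.Re (hdot (A e) e))%:E.

Definition trace_abs_pow (r : R) T : \bar R :=
  trace_op (cfc (fun x => x `^ r) (abs_op T)).

(* The exponent ranges over [1, +oo]; the value at -oo is irrelevant.  For
   finite p, the norm is +oo outside of the Schatten class. *)
Definition schatten_norm (p : \bar R) T : \bar R :=
  match p with
  | r%:E => poweR (trace_abs_pow r T) r^-1
  | +oo%E => opnorm T
  | -oo%E => 0%E
  end.

Definition schatten (p : \bar R) T : Prop :=
  match p with
  | r%:E => compact_op T /\ (trace_abs_pow r T < +oo)%E
  | +oo%E => bounded_op T
  | -oo%E => False
  end.

Definition re_op T : H -> H := (2^-1 : R[i]) \*: (T \+ adjoint T).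

Definition expi (theta : R) : R[i] := cos theta +i* sin theta.

Definition schatten_num_radius (p : \bar R) T : \bar R :=
  ereal_sup [set schatten_norm p (re_op (expi theta \*: T)) |
             theta in [set: R]].

Definition aluthge (f g : R -> R) T : H -> H :=
  cfc f (abs_op T) \o polar_op T \o cfc g (abs_op T).

End Operators.

Arguments separable_hilbert {R} H.

(* Main.v *)
(* Write T = U P with P = |T|, and T' for the adjoint of T.  As f(P) g(P) = P, the
   first two operators on the right are A = P U P and B = P U' P, so that
   T^2 = U A and T'^2 = B U'.  For X = Re(e^(i theta) T) and D = T' T + T T' this
   gives
     |X x|^2 <= (|<A x, U' x>| + |<B U' x, x>| + |<D x, x>|) / 4,
   which settles p = oo.  For p = 2r finite, X is compact, and in an orthonormal
   basis of eigenvectors e of X^2 the trace of |X|^p is the sum of the |X e|^(2r).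
   By Minkowski's inequality it suffices that the sum of the |<K V e, W e>|^r is
   at most tr(|K|^r) for all contractions V and W.  This follows from the polar
   decomposition of K, the Cauchy-Schwarz inequality for the form of |K| and
   Jensen's inequality <|K| x, x>^r <= <|K|^r x, x> for |x| <= 1.

   The functional calculus rests on the bound of the norm a of q(A), for A
   selfadjoint, by the values of |q| on the spectrum: q(A)^2 - a^2 is not bounded
   below, hence neither is A - z for some complex root z of q^2 - a^2. *)
Require Import Defs.
From mathcomp Require Import all_boot all_order all_algebra.
From mathcomp Require Import complex.
From mathcomp Require Import all_classical all_reals all_analysis.
From mathcomp Require Import ring lra.

Import Order.TTheory GRing.Theory Num.Theory.
Import numFieldNormedType.Exports.

Local Open Scope classical_set_scope.
Local Open Scope ring_scope.

Set Implicit Arguments.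
Unset Strict Implicit.
Unset Printing Implicit Defensive.

(** * Real-valued norms and inner products *)

Section RealNorm.
Context {R : realType}.
Local Notation C := R[i]%C.

(** The pointwise bound splits the cross term [2 Re (c^2 <T^2 x, x>)] of [4 |X x|^2] into two equal
    halves: one copy of [|<T^2 x, x>|] is written with A, the other, conjugated, with B. For finite
    p everything stays at the level of diagonal entries in one basis, so that the triangle
    inequality takes place between finite sums of r-th powers; [r >= 1] is where [p >= 2] enters.
    The obstacle is that the trace is taken in an arbitrary basis picked by [xget], whereas [|X|^p]
    is diagonal only in a suitable one. A double-sum exchange for the square root of a positive
    operator passes between bases; a contraction can be inserted there at no cost, and this is also
    how U' and the partial isometries of polar decompositions are absorbed. Adjoints, square roots,
    polar parts and functions of P are choices by [xget] too, hence informative only once existence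
    is proved: by Riesz representation for adjoints, by polynomial approximation on an interval
    containing the spectrum for square roots and functions of P, and by isometric extension for
    polar parts. *)

Definition rnorm {V : normedZmodType C} (x : V) : R := complex.Re `|x|.

Section Zmod.
Context {V : normedZmodType C}.
Implicit Types x y z : V.

Lemma rnormE x : `|x| = (rnorm x)%:C%C.
Proof. by rewrite RRe_real ?normr_real. Qed.

Lemma rnorm_le1 x : (`|x| <= 1) = (rnorm x <= 1).
Proof. by rewrite rnormE -(rmorph1 (real_complex R)) lecR. Qed.

Lemma rnorm_ge0 x : 0 <= rnorm x.
Proof. by rewrite -ler0c -rnormE. Qed.

Lemma rnorm_eq0 x : (rnorm x == 0) = (x == 0).
Proof. by rewrite -[RHS]normr_eq0 rnormE -(inj_eq (@complexI R)). Qed.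

Lemma rnorm_gt0 x : (0 < rnorm x) = (x != 0).
Proof. by rewrite lt_neqAle rnorm_ge0 andbT eq_sym rnorm_eq0. Qed.

Lemma rnorm0 : rnorm (0 : V) = 0.
Proof. by apply/eqP; rewrite rnorm_eq0. Qed.

Lemma rnormD x y : rnorm (x + y) <= rnorm x + rnorm y.
Proof. by rewrite -lecR rmorphD /= -!rnormE ler_normD. Qed.

Lemma rnormN x : rnorm (- x) = rnorm x.
Proof. by rewrite /rnorm normrN. Qed.

Lemma rnorm_distC x y : rnorm (x - y) = rnorm (y - x).
Proof. by rewrite /rnorm distrC. Qed.

Lemma rnormB x y : rnorm (x - y) <= rnorm x + rnorm y.
Proof. by rewrite (le_trans (rnormD _ _))// rnormN. Qed.

Lemma rnorm_dist_trans y x z : rnorm (x - z) <= rnorm (x - y) + rnorm (y - z).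
Proof. by rewrite -{1}(subrK y x) -addrA rnormD. Qed.

Lemma rnorm_le_dist x y : rnorm x - rnorm y <= rnorm (x - y).
Proof. by rewrite lerBlDr -{1}(subrK y x) rnormD. Qed.

Lemma rnorm_small x : (forall e, 0 < e -> rnorm x <= e) -> x = 0.
Proof.
move=> h; apply/eqP; rewrite -rnorm_eq0 eq_le rnorm_ge0 andbT.
by apply/ler_addgt0Pr => e /h; rewrite add0r.
Qed.

End Zmod.

Lemma rnormZ {V : normedModType C} (c : C) (x : V) :
  rnorm (c *: x) = rnorm (c : C^o) * rnorm x.
Proof.
by apply: complexI; rewrite rmorphM /= -!rnormE normrZ.
Qed.

Lemma rnormM (c d : C) : rnorm (c * d) = rnorm c * rnorm d.
Proof. by apply: complexI; rewrite rmorphM /= -!rnormE normrM. Qed.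

Lemma rnormC (c : R) : rnorm c%:C%C = `|c|.
Proof. by rewrite /rnorm normc_def /= expr0n addr0 sqrtr_sqr. Qed.

Lemma rnorm_conj (c : C) : rnorm c^*%C = rnorm c.
Proof. by rewrite /rnorm normcJ. Qed.

Lemma rnorm_sqr (c : C) : rnorm c ^+ 2 = complex.Re c ^+ 2 + complex.Im c ^+ 2.
Proof.
by apply: complexI; rewrite rmorphXn /= -rnormE add_Re2_Im2.
Qed.

Lemma Re_le_rnorm (c : C) : `|complex.Re c| <= rnorm c.
Proof. by rewrite -lecR -rnormE normc_ge_Re. Qed.

Lemma Re_ge_rnorm (c : C) : complex.Re c <= rnorm c.
Proof. exact: le_trans (ler_norm _) (Re_le_rnorm c). Qed.

Lemma Re_realM (a : R) (c : C) : complex.Re (a%:C%C * c) = a * complex.Re c.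
Proof. by case: c => c d /=; rewrite mul0r subr0. Qed.

Lemma phaseP (c : C) : exists u : C, rnorm u = 1 /\ u * c = (rnorm c)%:C%C.
Proof.
have [->|c0] := eqVneq c 0.
  by exists 1; rewrite mulr0 rnorm0; split => //; rewrite /rnorm normr1.
exists (c^*%C / `|c|); split.
  apply: complexI; rewrite -rnormE normrM normfV normr_id.
  by rewrite [`|c^*%C|]normcJ divff// normr_eq0.
rewrite -rnormE mulrAC [_ * c]mulrC -sqr_normc expr2 mulfK//.
by rewrite normr_eq0.
Qed.

End RealNorm.

Section InnerProduct.
Context {R : realType} {H : hilbertType R}.
Local Notation C := R[i]%C.
Implicit Types x y z : H.

Definition rdot x y : R := complex.Re (hdot x y).

Lemma hdotDl x y z : hdot (x + y) z = hdot x z + hdot y z.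
Proof. exact: linearDl. Qed.
Lemma hdotDr x y z : hdot z (x + y) = hdot z x + hdot z y.
Proof. exact: linearDr. Qed.
Lemma hdotNl x z : hdot (- x) z = - hdot x z.
Proof. exact: linearNl. Qed.
Lemma hdotNr x z : hdot z (- x) = - hdot z x.
Proof. exact: linearNr. Qed.
Lemma hdotBl x y z : hdot (x - y) z = hdot x z - hdot y z.
Proof. by rewrite hdotDl hdotNl. Qed.
Lemma hdotBr x y z : hdot z (x - y) = hdot z x - hdot z y.
Proof. by rewrite hdotDr hdotNr. Qed.
Lemma hdot0l z : hdot 0 z = 0.
Proof. exact: linear0l. Qed.
Lemma hdot0r z : hdot z 0 = 0.
Proof. exact: linear0r. Qed.
Lemma hdotZl (a : C) x z : hdot (a *: x) z = a * hdot x z.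
Proof. exact: linearZl_LR. Qed.
Lemma hdotC x y : hdot x y = (hdot y x)^*%C.
Proof. by rewrite (hermC hdot) expr0 mul1r. Qed.
Lemma hdotZr (a : C) x z : hdot z (a *: x) = a^*%C * hdot z x.
Proof. by rewrite hdotC hdotZl rmorphM /= -hdotC. Qed.
Lemma hdot_suml I (r : seq I) (P : pred I) (F : I -> H) z :
  hdot (\sum_(i <- r | P i) F i) z = \sum_(i <- r | P i) hdot (F i) z.
Proof.
by apply: (big_morph (fun x => hdot x z)) => [x y|]; rewrite ?hdotDl ?hdot0l.
Qed.

Lemma hdotxx x : hdot x x = (rnorm x ^+ 2)%:C%C.
Proof. by rewrite hdot_norm rnormE rmorphXn. Qed.

Lemma rdotxx x : rdot x x = rnorm x ^+ 2.
Proof. by rewrite /rdot hdotxx. Qed.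
Lemma rdotC x y : rdot x y = rdot y x.
Proof. by rewrite /rdot hdotC; case: (hdot y x). Qed.
Lemma rdotDl x y z : rdot (x + y) z = rdot x z + rdot y z.
Proof. by rewrite /rdot hdotDl raddfD. Qed.
Lemma rdotDr x y z : rdot z (x + y) = rdot z x + rdot z y.
Proof. by rewrite /rdot hdotDr raddfD. Qed.
Lemma rdotNl x z : rdot (- x) z = - rdot x z.
Proof. by rewrite /rdot hdotNl raddfN. Qed.
Lemma rdotNr x z : rdot z (- x) = - rdot z x.
Proof. by rewrite /rdot hdotNr raddfN. Qed.
Lemma rdotBl x y z : rdot (x - y) z = rdot x z - rdot y z.
Proof. by rewrite rdotDl rdotNl. Qed.
Lemma rdotZl (a : R) x z : rdot (a%:C%C *: x) z = a * rdot x z.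
Proof. by rewrite /rdot hdotZl Re_realM. Qed.
Lemma rdotZr (a : R) x z : rdot z (a%:C%C *: x) = a * rdot z x.
Proof. by rewrite rdotC rdotZl rdotC. Qed.

Lemma rnormRZ (a : R) x : rnorm (a%:C%C *: x) = `|a| * rnorm x.
Proof. by rewrite rnormZ rnormC. Qed.

Lemma rnormD_sqr x y :
  rnorm (x + y) ^+ 2 = rnorm x ^+ 2 + rnorm y ^+ 2 + 2 * rdot x y.
Proof. by rewrite -!rdotxx rdotDl !rdotDr (rdotC y x); ring. Qed.

Lemma rnormB_sqr x y :
  rnorm (x - y) ^+ 2 = rnorm x ^+ 2 + rnorm y ^+ 2 - 2 * rdot x y.
Proof. by rewrite rnormD_sqr rdotNr rnormN; ring. Qed.

Lemma parallelogram x y :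
  rnorm (x + y) ^+ 2 + rnorm (x - y) ^+ 2 = 2 * rnorm x ^+ 2 + 2 * rnorm y ^+ 2.
Proof. by rewrite rnormB_sqr rnormD_sqr; ring. Qed.

Lemma rdot_le x y : rdot x y <= rnorm x * rnorm y.
Proof.
have [->|y0] := eqVneq y 0; first by rewrite /rdot hdot0r /= rnorm0 mulr0.
have [->|x0] := eqVneq x 0; first by rewrite /rdot hdot0l /= rnorm0 mul0r.
have yp : 0 < rnorm y by rewrite rnorm_gt0.
have xp : 0 < rnorm x by rewrite rnorm_gt0.
(* The squared norm of [|y| x - |x| y] is [2 |x| |y| (|x| |y| - Re <x, y>)]. *)
have := sqr_ge0 (rnorm ((rnorm y)%:C%C *: x - (rnorm x)%:C%C *: y)).
rewrite rnormB_sqr rdotZl rdotZr !rnormRZ !ger0_norm ?rnorm_ge0// => h.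
have {h}: 0 <= (2 * (rnorm x * rnorm y)) * (rnorm x * rnorm y - rdot x y).
  by apply: le_trans h _; rewrite le_eqVlt; apply/orP; left; apply/eqP; ring.
by rewrite pmulr_rge0 ?subr_ge0// mulr_gt0// mulr_gt0.
Qed.

(** A unit scalar [u] makes [u <x, y>] real and non-negative, which reduces the complex inequality
    to the real one. *)
Lemma CauchySchwarz x y : rnorm (hdot x y) <= rnorm x * rnorm y.
Proof.
have [u [u1 uE]] := phaseP (hdot x y).
have : rdot (u *: x) y = rnorm (hdot x y) by rewrite /rdot hdotZl uE.
by move=> <-; rewrite (le_trans (rdot_le _ _))// rnormZ u1 mul1r.
Qed.

Lemma rdot_norm_le x y : `|rdot x y| <= rnorm x * rnorm y.
Proof. exact: le_trans (Re_le_rnorm _) (CauchySchwarz _ _). Qed.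

Lemma Im_hdot x y : complex.Im (hdot x y) = - rdot ('i%C *: x) y.
Proof. by rewrite /rdot hdotZl mulrC ReiNIm opprK. Qed.

Lemma hdot_ext x y : (forall z, hdot z x = hdot z y) -> x = y.
Proof.
move=> h; apply/eqP; rewrite -subr_eq0 -rnorm_eq0 -sqrf_eq0 -rdotxx /rdot.
by rewrite hdotBr h subrr.
Qed.

End InnerProduct.

(** * Bounded operators and their bounds *)

Section Operators.
Context {R : realType} {H : hilbertType R}.
Local Notation C := R[i]%C.
Implicit Types (S T A B : H -> H) (x y : H) (M : R).

Section Linear.
Variable T : H -> H.
Hypothesis lT : linear T.

Lemma linD x y : T (x + y) = T x + T y.
Proof. by have := lT 1 x y; rewrite !scale1r. Qed.
Lemma lin0 : T 0 = 0.
Proof. by apply: (addrI (T 0)); rewrite -linD !addr0. Qed.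
Lemma linZ (a : C) x : T (a *: x) = a *: T x.
Proof. by have := lT a x 0; rewrite !addr0 lin0 addr0. Qed.
Lemma linN x : T (- x) = - T x.
Proof. by rewrite -scaleN1r linZ scaleN1r. Qed.
Lemma linB x y : T (x - y) = T x - T y.
Proof. by rewrite linD linN. Qed.
Lemma lin_sum I (r : seq I) (P : pred I) (F : I -> H) :
  T (\sum_(i <- r | P i) F i) = \sum_(i <- r | P i) T (F i).
Proof. exact: (big_morph T linD lin0). Qed.
End Linear.

Definition bound_op M T := 0 <= M /\ forall x, rnorm (T x) <= M * rnorm x.

Lemma bounded_bound T : bounded_op T -> exists2 M : R, 0 < M & bound_op M T.
Proof.
case=> lT cT.
have := cT 0; rewrite /continuous_at lin0// => /cvgrPdist_lt /(_ 1 ltr01).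
move=> /nbhs_ballP[e /= e0]; rewrite -ball_normE /ball_ /= => h.
have e0' : 0 < complex.Re e by move: e0; rewrite ltcE => /andP[].
have eE : e = (complex.Re e)%:C%C by rewrite RRe_real// gtr0_real.
(* On the ball of radius [d] the image has norm below 1. Scaling [x] to norm [d / 2] stays strictly
   inside it, whence the constant [2 / d]. *)
set d := complex.Re e in e0' eE.
exists (2 / d); first by rewrite divr_gt0.
split; first by rewrite ltW// divr_gt0.
move=> x; have [->|x0] := eqVneq x 0; first by rewrite lin0// rnorm0 mulr0.
have xp : 0 < rnorm x by rewrite rnorm_gt0.
have /= := h ((d / 2 / rnorm x)%:C%C *: x).
rewrite !sub0r !normrN linZ// [in _ < 1]rnormE.
rewrite -(rmorph1 (real_complex R)) !rnormE eE !ltcR !rnormRZ.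
rewrite ger0_norm; last by rewrite !divr_ge0// ltW.
rewrite divfK ?gt_eqF// => /(_ _)/ltW h'.
have: d / 2 / rnorm x * rnorm (T x) <= 1 by apply: h'; lra.
rewrite -ler_pdivlMl ?mulr1; last by rewrite !divr_gt0.
move=> /le_trans; apply; rewrite le_eqVlt; apply/orP; left; apply/eqP.
by field; rewrite !gt_eqF.
Qed.

Lemma bound_bounded M T : linear T -> bound_op M T -> bounded_op T.
Proof.
move=> lT [M0 hM]; split=> // x.
apply/cvgrPdist_lt => /= e e0.
have e0' : 0 < complex.Re e by move: e0; rewrite ltcE => /andP[].
have eE : e = (complex.Re e)%:C%C by rewrite RRe_real// gtr0_real.
near=> y; rewrite -linB// rnormE eE ltcR.
apply: (le_lt_trans (hM _)).
apply: (@le_lt_trans _ _ ((M + 1) * rnorm (x - y))).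
  by rewrite ler_wpM2r ?rnorm_ge0// lerDl.
rewrite mulrC -ltr_pdivlMr; last by rewrite ltr_wpDl.
rewrite -ltcR -rnormE; near: y.
apply: (@cvgr_dist_lt _ _ _ _ _ id) => //.
by rewrite ltcR divr_gt0// ltr_wpDl.
Unshelve. all: by end_near. Qed.

Lemma bounded_lin T : bounded_op T -> linear T. Proof. by case. Qed.

Lemma bounded_comp S T : bounded_op S -> bounded_op T -> bounded_op (S \o T).
Proof.
move=> bS bT; have [M _ [M0 hM]] := bounded_bound bS.
have [N _ [N0 hN]] := bounded_bound bT.
apply: (@bound_bounded (M * N)).
  by move=> a x y /=; rewrite (bounded_lin bT) (bounded_lin bS).
split=> [|x /=]; first exact: mulr_ge0.
by rewrite (le_trans (hM _))// -mulrA ler_wpM2l.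
Qed.

Lemma bounded_add S T : bounded_op S -> bounded_op T -> bounded_op (S \+ T).
Proof.
move=> bS bT; have [M _ [M0 hM]] := bounded_bound bS.
have [N _ [N0 hN]] := bounded_bound bT.
apply: (@bound_bounded (M + N)).
  move=> a x y /=; rewrite (bounded_lin bT) (bounded_lin bS) scalerDr.
  by rewrite addrACA.
split=> [|x /=]; first exact: addr_ge0.
by rewrite (le_trans (rnormD _ _))// mulrDl lerD.
Qed.

Lemma bounded_scale (a : C) T : bounded_op T -> bounded_op (a \*: T).
Proof.
move=> bT; have [N _ [N0 hN]] := bounded_bound bT.
apply: (@bound_bounded (rnorm a * N)).
  move=> b x y /=; rewrite (bounded_lin bT) scalerDr !scalerA.
  by rewrite (mulrC a b).
split=> [|x /=]; first by rewrite mulr_ge0 ?rnorm_ge0.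
by rewrite rnormZ -mulrA ler_wpM2l ?rnorm_ge0.
Qed.

Lemma bounded_id : bounded_op (@id H).
Proof.
apply: (@bound_bounded 1) => //; split=> // x; by rewrite mul1r.
Qed.

Lemma bounded0 : bounded_op (fun=> 0 : H).
Proof.
apply: (@bound_bounded 0); first by move=> a x y; rewrite scaler0 addr0.
by split=> // x; rewrite rnorm0 mul0r.
Qed.

Lemma opnorm_le M T : linear T -> 0 <= M ->
  (forall x, rnorm (T x) <= M * rnorm x) <-> (opnorm T <= M%:E)%E.
Proof.
move=> lT M0; split=> h.
  apply: ge_ereal_sup => _ [x /= x1 <-]; rewrite lee_fin.
  rewrite (le_trans (h x))// ler_piMr//.
  by rewrite -rnorm_le1.
move=> x; have [->|x0] := eqVneq x 0; first by rewrite lin0// rnorm0 mulr0.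
have xp : 0 < rnorm x by rewrite rnorm_gt0.
have : ((complex.Re `|T ((rnorm x)^-1%:C%C *: x)|)%:E <= M%:E)%E.
  apply: le_trans h; apply: ereal_sup_ubound.
  exists ((rnorm x)^-1%:C%C *: x) => //=.
  rewrite rnorm_le1 rnormRZ ger0_norm ?invr_ge0 ?rnorm_ge0//.
  by rewrite mulVf ?gt_eqF.
rewrite lee_fin -/(rnorm _) linZ// rnormRZ ger0_norm ?invr_ge0 ?rnorm_ge0//.
by rewrite -ler_pdivlMl ?invr_gt0// invrK mulrC.
Qed.

End Operators.
Lemma le_eps {R : realType} (a b : R) :
  (forall e : R, 0 < e -> a <= b + e) -> a <= b.
Proof. by move=> h; apply/ler_addgt0Pr. Qed.

(** * Projections, Riesz representation, adjoints *)

Section Completeness.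
Context {R : realType} {H : hilbertType R}.
Local Notation C := R[i]%C.
Implicit Types (x y z : H) (u : nat -> H) (M : set H).

(** Balls of [H] are indexed by positive elements of [R[i]], which are real; this is completeness
    with real radii. The filter form also serves for the image of an ultrafilter, where no sequence
    is at hand. *)
Lemma filter_complete (F : set_system H) : ProperFilter F ->
  (forall e : R, 0 < e -> exists x, F [set y | rnorm (x - y) < e]) ->
  exists l, forall e : R, 0 < e -> F [set y | rnorm (l - y) < e].
Proof.
move=> FF hF.
have cF : cauchy F.
  apply: cauchy_exP => e e0.
  have e0' : 0 < complex.Re e by move: e0; rewrite ltcE => /andP[].
  have eE : e = (complex.Re e)%:C%C by rewrite RRe_real// gtr0_real.
  have [x hx] := hF _ e0'; exists x; apply: filterS hx => y /=.
  by rewrite -ball_normE /ball_ /= rnormE eE ltcR.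
have [l hl] : exists l : H, F --> l.
  by apply/cvg_ex; apply: cauchy_cvg.
exists l => e e0.
have eC : 0 < (e%:C)%C :> C by rewrite ltcR.
have /hl/= := nbhsx_ballx l _ eC.
by apply: filterS => y; rewrite -ball_normE /ball_ /= rnormE ltcR.
Qed.

Definition slim u l :=
  forall e : R, 0 < e -> exists N, forall n, (N <= n)%N -> rnorm (u n - l) < e.

Lemma seq_complete u :
  (forall e : R, 0 < e -> exists N, forall m n, (N <= m)%N -> (N <= n)%N ->
    rnorm (u m - u n) < e) ->
  exists l, slim u l.
Proof.
move=> hu.
have [e e0|l hl] := @filter_complete (u @ \oo) _.
  have [N hN] := hu e e0; exists (u N).
  by exists N => //= n /= Nn; apply: hN.
exists l => e e0; have [N _ hN] := hl e e0.
by exists N => n Nn; rewrite rnorm_distC; apply: hN.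
Qed.

Definition subspace M := M 0 /\ forall (a : C) x y, M x -> M y -> M (a *: x + y).
Definition eclosed M := forall x,
  (forall e : R, 0 < e -> exists2 y, M y & rnorm (x - y) < e) -> M x.

Lemma subspaceZ M : subspace M -> forall (a : C) x, M x -> M (a *: x).
Proof. by move=> [M0 h] a x Mx; rewrite -[_ *: _]addr0; apply: h. Qed.
Lemma subspaceD M : subspace M -> forall x y, M x -> M y -> M (x + y).
Proof. by move=> [M0 h] x y Mx My; rewrite -[x]scale1r; apply: h. Qed.
(** Nearest-point argument: a minimizing sequence in [M] is Cauchy by the parallelogram law, and
    minimality along the lines through its limit forces orthogonality. *)
Lemma projection M : subspace M -> eclosed M ->
  forall x, exists2 m, M m & forall y, M y -> hdot (x - m) y = 0.
Proof.
move=> sM cM x.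
set D := [set rnorm (x - m) | m in M].
have D0 : has_inf D.
  split; first by exists (rnorm (x - 0)), 0 => //; case: sM.
  by exists 0 => _ [m _ <-]; rewrite rnorm_ge0.
set d := inf D.
have d0 : 0 <= d.
  by apply: lb_le_inf; [case: D0|move=> _ [m _ <-]; rewrite rnorm_ge0].
have dle m : M m -> d <= rnorm (x - m).
  by move=> Mm; apply: inf_lbound; [case: D0|exists m].
have /choice[u hu] : forall n : nat, exists m, M m /\ rnorm (x - m) < d + n.+1%:R^-1.
  move=> n; have n0 : 0 < n.+1%:R^-1 :> R by rewrite invr_gt0 ltr0n.
  by have [_ [m Mm <-] hm] := inf_adherent n0 D0; exists m.
(* The midpoint of [m] and [n] lies in [M], hence at distance at least [d] from [x]; the
   parallelogram law leaves [|m - n|^2 <= 4 (d + e)^2 - 4 d^2]. *)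
have key m n (e : R) : M m -> M n -> 0 <= e -> rnorm (x - m) <= d + e ->
    rnorm (x - n) <= d + e -> rnorm (m - n) ^+ 2 <= 8 * d * e + 4 * e ^+ 2.
  move=> Mm Mn e0 hm hn.
  have := parallelogram (x - m) (x - n).
  have -> : x - m - (x - n) = n - m by rewrite opprB addrC addrA subrK.
  have -> : x - m + (x - n) = 2%:C%C *: (x - (2^-1)%:C%C *: (m + n)).
    rewrite scalerBr scalerA -rmorphM /= divff ?pnatr_eq0// scale1r.
    by rewrite rmorph_nat scaler_nat mulr2n opprD addrACA.
  rewrite rnormRZ ger0_norm// (rnorm_distC n m) => h.
  have hmid : d <= rnorm (x - (2^-1)%:C%C *: (m + n)).
    by apply: dle; apply: subspaceZ => //; apply: subspaceD.
  have h1 : d ^+ 2 <= rnorm (x - (2^-1)%:C%C *: (m + n)) ^+ 2.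
    by rewrite ler_pXn2r ?nnegrE ?rnorm_ge0.
  have h2 : rnorm (x - m) ^+ 2 <= (d + e) ^+ 2.
    by rewrite ler_pXn2r ?nnegrE ?rnorm_ge0// addr_ge0.
  have h3 : rnorm (x - n) ^+ 2 <= (d + e) ^+ 2.
    by rewrite ler_pXn2r ?nnegrE ?rnorm_ge0// addr_ge0.
  by move: h; rewrite exprMn => h; nra.
have [e e0|l hl] := @seq_complete u.
  (* As [e1 <= 1], one has [8 d e1 + 4 e1^2 <= e1 (8 d + 4)]; the 5 makes the comparison with [e^2]
     strict. *)
  set e1 : R := Num.min 1 (e ^+ 2 / (8 * d + 5)).
  have e10 : 0 < e1.
    by rewrite lt_min ltr01 /= divr_gt0 ?exprn_gt0//; lra.
  have [N hN] : exists N : nat, N.+1%:R^-1 < e1.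
    have /archi_boundP : 0 <= e1^-1 by rewrite invr_ge0 ltW.
    set k := Num.bound _ => hk; exists k.
    rewrite invf_plt ?posrE//; apply: lt_trans hk _.
    by rewrite ltr_nat.
  exists N => m n Nm Nn.
  have hle k : (N <= k)%N -> rnorm (x - u k) <= d + e1.
    move=> Nk; apply: (le_trans (ltW (hu k).2)); rewrite lerD2l.
    apply: le_trans (ltW hN); rewrite lef_pV2 ?posrE// ler_nat.
    by rewrite ltnS.
  have h := key _ _ _ (hu m).1 (hu n).1 (ltW e10) (hle _ Nm) (hle _ Nn).
  rewrite -(@ltr_pXn2r _ 2) ?nnegrE ?rnorm_ge0 ?(ltW e0)//.
  apply: (le_lt_trans h).
  have a1 : e1 <= 1 by rewrite ge_min lexx.
  have a2 : e1 * (8 * d + 5) <= e ^+ 2.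
    rewrite -ler_pdivlMr; last lra.
    by rewrite ge_min lexx orbT.
  nra.
have Ml : M l.
  apply: cM => e e0; have [N hN] := hl e e0; exists (u N); first exact: (hu N).1.
  by rewrite rnorm_distC hN.
have hxl : rnorm (x - l) <= d.
  apply: le_eps => e e0.
  have [N1 hN1] := hl _ (divr_gt0 e0 (ltr0n _ 2)).
  have [N2 hN2] : exists N : nat, N.+1%:R^-1 < e / 2.
    have /archi_boundP : 0 <= (e / 2)^-1 by rewrite invr_ge0 ltW// divr_gt0.
    set k := Num.bound _ => hk; exists k.
    rewrite invf_plt ?posrE// ?divr_gt0//; apply: lt_trans hk _.
    by rewrite ltr_nat.
  set n := maxn N1 N2.
  have h1 := hN1 n (leq_maxl _ _).
  have h2 : n.+1%:R^-1 < e / 2.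
    apply: le_lt_trans hN2; rewrite lef_pV2 ?posrE// ler_nat ltnS.
    exact: leq_maxr.
  apply: (le_trans (rnorm_dist_trans (u n) _ _)).
  apply: (le_trans (lerD (ltW (hu n).2) (ltW h1))).
  by rewrite -addrA lerD2l {2}(splitr e) lerD2r ltW.
exists l => //.
have hr y : M y -> rdot (x - l) y = 0.
  move=> My; have [->|y0] := eqVneq y 0; first by rewrite /rdot hdot0r.
  have yp : 0 < rnorm y by rewrite rnorm_gt0.
  (* The coefficient that minimizes [|x - l - t y|]. *)
  set t := rdot (x - l) y / rnorm y ^+ 2.
  have : rnorm (x - l) <= rnorm (x - l - t%:C%C *: y).
    apply: (le_trans hxl); rewrite -addrA -opprD; apply: dle.
    by apply: subspaceD => //; apply: subspaceZ.
  rewrite -(@ler_pXn2r _ 2) ?nnegrE ?rnorm_ge0// (rnormB_sqr (x - l)) rdotZr rnormRZ.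
  rewrite exprMn real_normK ?num_real// => h.
  have tE : t * rnorm y ^+ 2 = rdot (x - l) y by rewrite divfK// expf_neq0// gt_eqF.
  have : t ^+ 2 * rnorm y ^+ 2 <= 0.
    clearbody t; rewrite -tE in h; lra.
  rewrite -exprMn => h2.
  have /eqP : (t * rnorm y) ^+ 2 = 0 by apply/eqP; rewrite eq_le h2 sqr_ge0.
  rewrite sqrf_eq0 mulf_eq0 (gt_eqF yp) orbF => /eqP t0.
  by rewrite -tE t0 mul0r.
move=> y My; apply/eqP; rewrite eq_complex; apply/andP; split; apply/eqP.
  exact: hr.
rewrite hdotC.
have -> : complex.Im ((hdot y (x - l))^*)%C = - complex.Im (hdot y (x - l)).
  by case: (hdot y _).
by rewrite Im_hdot opprK rdotC hr//; apply: subspaceZ.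
Qed.

Lemma orthogonal_complement_trivial M : subspace M -> eclosed M ->
  (forall z, (forall y, M y -> hdot z y = 0) -> z = 0) -> forall x, M x.
Proof.
move=> sM cM h x; have [m Mm hm] := projection sM cM x.
by rewrite -(subrK m x) (h _ hm) add0r.
Qed.

(** A non-zero [w] orthogonal to the kernel represents [phi] up to a scalar, because
    [x - (phi x / phi w) w] always lies in the kernel. *)
Lemma riesz (phi : H -> C) (K : R) :
  (forall (a : C) x y, phi (a *: x + y) = a * phi x + phi y) ->
  0 <= K -> (forall x, rnorm (phi x) <= K * rnorm x) ->
  exists v, forall x, phi x = hdot x v.
Proof.
move=> lphi K0 hK.
have phi0 : phi 0 = 0.
  have := lphi 1 0 0; rewrite scale1r addr0 mul1r => h.
  by apply: (addrI (phi 0)); rewrite addr0 -h.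
have phiZ a x : phi (a *: x) = a * phi x by rewrite -[a *: x]addr0 lphi phi0 addr0.
have phiB x y : phi (x - y) = phi x - phi y.
  have -> : x - y = (-1) *: y + x by rewrite scaleN1r addrC.
  by rewrite lphi mulN1r addrC.
have [all0|] := pselect (forall x, phi x = 0).
  by exists 0 => x; rewrite all0 hdot0r.
move=> /existsNP[z /eqP z0].
set M := [set x | phi x = 0].
have sM : subspace M.
  by split=> // a x y hx hy; rewrite /M /= lphi hx hy mulr0 addr0.
have cM : eclosed M.
  move=> x hx /=; apply: rnorm_small => e e0.
  have [y /= My hy] := hx (e / (K + 1)) (divr_gt0 e0 (ltr_wpDl K0 ltr01)).
  have -> : phi x = phi (x - y) by rewrite phiB My subr0.
  apply: (le_trans (hK _)); apply: (@le_trans _ _ (K * (e / (K + 1)))).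
    by rewrite ler_wpM2l// ltW.
  rewrite mulrCA -[leRHS]mulr1 ler_wpM2l ?(ltW e0)//.
  by rewrite ler_pdivrMr ?mul1r ?lerDl// ltr_wpDl.
have [m /= Mm hm] := projection sM cM z.
set w := z - m in hm.
have phiw : phi w != 0 by rewrite /w phiB Mm subr0.
have w0 : w != 0 by apply: contra_neq phiw => ->.
exists (((phi w) / (rnorm w ^+ 2)%:C%C)^*%C *: w) => x.
have : hdot w (x - (phi x / phi w) *: w) = 0.
  by apply: hm => /=; rewrite /M /= (phiB x) phiZ divfK ?subrr.
rewrite hdotC => /(congr1 conjc); rewrite conjcK rmorph0.
rewrite hdotBl hdotZl hdotxx => /eqP; rewrite subr_eq0 => /eqP h.
rewrite hdotZr conjcK h; have rw0 : rnorm w != 0 by rewrite rnorm_eq0.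
by field; rewrite phiw fmorph_eq0.
Qed.

End Completeness.

Section Adjoint.
Context {R : realType} {H : hilbertType R}.
Local Notation C := R[i]%C.
Implicit Types (S T A B : H -> H) (x y : H) (M : R).

Lemma adjoint_spec T : bounded_op T -> bounded_op (adjoint T) /\
  forall x y, hdot (T x) y = hdot x (adjoint T y).
Proof.
move=> bT; rewrite /adjoint; set P := (X in xget _ X).
suff : P (xget (fun=> 0) P) by [].
apply: xgetPex.
have [K Kp [K0 hK]] := bounded_bound bT.
have /choice[B hB] y : exists v, forall x, hdot (T x) y = hdot x v.
  apply: (@riesz _ _ _ (K * rnorm y)); last 2 first.
  - by rewrite mulr_ge0 ?rnorm_ge0.
  - move=> x; rewrite (le_trans (CauchySchwarz _ _))// mulrAC.
    by rewrite ler_wpM2r ?rnorm_ge0.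
  by move=> a u v; rewrite (bounded_lin bT) hdotDl hdotZl.
exists B; split=> [|x y]; last exact: hB.
apply: (@bound_bounded _ _ K).
  move=> a u v; apply: hdot_ext => z.
  by rewrite -hB !hdotDr !hdotZr !hB.
split=> // y; have [->|y0] := eqVneq (B y) 0.
  by rewrite rnorm0 mulr_ge0// rnorm_ge0.
have yp : 0 < rnorm (B y) by rewrite rnorm_gt0.
(* [|B y|^2 = <T (B y), y>], so the bound [K] of [T] also serves for [B]. *)
rewrite -(ler_pM2l yp) -expr2 -rdotxx /rdot -hB.
apply: (le_trans (rdot_le _ _)); rewrite mulrA (mulrC (rnorm _) K).
by rewrite ler_wpM2r ?rnorm_ge0.
Qed.

Lemma bounded_adjoint T : bounded_op T -> bounded_op (adjoint T).
Proof. by move=> /adjoint_spec[]. Qed.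

Lemma adjointE T : bounded_op T ->
  forall x y, hdot (T x) y = hdot x (adjoint T y).
Proof. by move=> /adjoint_spec[]. Qed.

Lemma adjointEl T : bounded_op T ->
  forall x y, hdot (adjoint T x) y = hdot x (T y).
Proof. by move=> bT x y; rewrite hdotC -adjointE// -hdotC. Qed.

Lemma adjoint_unique T B : bounded_op T ->
  (forall x y, hdot (T x) y = hdot x (B y)) -> adjoint T = B.
Proof.
move=> bT hB; apply/funext => y; apply: hdot_ext => z.
by rewrite -adjointE.
Qed.

Lemma bound_adjoint M T : bounded_op T -> bound_op M T -> bound_op M (adjoint T).
Proof.
move=> bT [M0 hM]; split=> // y.
have [->|y0] := eqVneq (adjoint T y) 0.
  by rewrite rnorm0 mulr_ge0// rnorm_ge0.
have yp : 0 < rnorm (adjoint T y).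
  by rewrite rnorm_gt0.
rewrite -(ler_pM2l yp) -expr2 -rdotxx /rdot -adjointE//.
apply: (le_trans (rdot_le _ _)); rewrite mulrA (mulrC (rnorm _) M).
by rewrite ler_wpM2r ?rnorm_ge0.
Qed.

Definition selfadjoint A := forall x y, hdot (A x) y = hdot x (A y).

Lemma adjoint_self A : bounded_op A -> selfadjoint A -> adjoint A = A.
Proof. by move=> bA sA; apply: adjoint_unique. Qed.

End Adjoint.
(** * Polynomials of an operator and its spectrum *)

Section PolynomialCalculus.
Context {R : realType} {H : hilbertType R}.
Local Notation C := R[i]%C.
Implicit Types (S T A B : H -> H) (x y : H) (M : R) (p q : {poly C}).

(** Complex coefficients, unlike in [poly_op], so that a polynomial in [A] splits into linear
    factors. *)
Definition cpoly_op (q : {poly C}) A : H -> H :=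
  fun x => \sum_(i < size q) q`_i *: iter i A x.

Lemma cpoly_op_wide n q A x : (size q <= n)%N ->
  cpoly_op q A x = \sum_(i < n) q`_i *: iter i A x.
Proof.
move=> qn; rewrite /cpoly_op (big_ord_widen n (fun i => q`_i *: iter i A x))//.
rewrite big_mkcond; apply: eq_bigr => i _; case: ltnP => // /(nth_default 0) ->.
by rewrite scale0r.
Qed.

Lemma cpoly_opD p q A x : cpoly_op (p + q) A x = cpoly_op p A x + cpoly_op q A x.
Proof.
set n := maxn (size p) (size q).
rewrite !(@cpoly_op_wide n) ?leq_maxl ?leq_maxr ?size_polyD//.
by rewrite -big_split; apply: eq_bigr => i _; rewrite coefD scalerDl.
Qed.

Lemma cpoly_opZ (c : C) q A x : cpoly_op (c *: q) A x = c *: cpoly_op q A x.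
Proof.
rewrite (@cpoly_op_wide (size q)) ?size_scale_leq// scaler_sumr.
by apply: eq_bigr => i _; rewrite coefZ scalerA.
Qed.

Lemma cpoly_opC (c : C) A x : cpoly_op c%:P A x = c *: x.
Proof.
rewrite (@cpoly_op_wide 1) ?size_polyC ?leq_b1//.
by rewrite big_ord1 coefC.
Qed.

Lemma cpoly_op0 A x : cpoly_op 0 A x = 0.
Proof. by rewrite cpoly_opC scale0r. Qed.

Lemma cpoly_opMX q A x : cpoly_op (q * 'X) A x = cpoly_op q A (A x).
Proof.
rewrite (@cpoly_op_wide (size q).+1); last first.
  by rewrite (leq_trans (size_polyMleq _ _))// size_polyX addn2.
rewrite big_ord_recl coefMX scale0r add0r; apply: eq_bigr => i _.
by rewrite coefMX /= -iterSr.
Qed.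

Lemma cpoly_opMXD q (c : C) A x :
  cpoly_op (q * 'X + c%:P) A x = cpoly_op q A (A x) + c *: x.
Proof. by rewrite cpoly_opD cpoly_opMX cpoly_opC. Qed.

Lemma bounded_cpoly q A : bounded_op A -> bounded_op (cpoly_op q A).
Proof.
move=> bA; elim/poly_ind: q => [|q c IH].
  rewrite (_ : cpoly_op 0 A = fun=> 0); first exact: bounded0.
  by apply/funext => x; rewrite cpoly_op0.
rewrite (_ : cpoly_op _ A = (cpoly_op q A \o A) \+ (c \*: id)).
  by apply: bounded_add (bounded_comp IH bA) (bounded_scale _ bounded_id).
by apply/funext => x; rewrite cpoly_opMXD.
Qed.

Lemma cpoly_opA q A x : bounded_op A -> A (cpoly_op q A x) = cpoly_op q A (A x).
Proof.
move=> bA; have lA := bounded_lin bA; rewrite (lin_sum lA); apply: eq_bigr => i _.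
by rewrite (linZ lA) -iterSr -iterS.
Qed.

Lemma cpoly_opM p q A x : bounded_op A ->
  cpoly_op (p * q) A x = cpoly_op p A (cpoly_op q A x).
Proof.
move=> bA; elim/poly_ind: p x => [|p c IH] x; first by rewrite mul0r !cpoly_op0.
rewrite mulrDl -mulrA (mulrC 'X) mulrA cpoly_opD cpoly_opMX IH mul_polyC.
by rewrite cpoly_opZ cpoly_opMXD cpoly_opA.
Qed.

(** Stands in for invertibility: an operator with a bounded inverse is bounded below, and
    [selfadjoint_inverse] gives the converse for selfadjoint ones. *)
Definition bounded_below S := exists2 d : R, 0 < d &
  forall x, d * rnorm x <= rnorm (S x).

Lemma bounded_below_prod A (rs : seq C) : bounded_op A ->
  (forall z, z \in rs -> bounded_below (fun x => A x - z *: x)) ->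
  bounded_below (cpoly_op (\prod_(z <- rs) ('X - z%:P)) A).
Proof.
move=> bA; elim: rs => [|z rs IH] h.
  by exists 1 => // x; rewrite big_nil cpoly_opC scale1r mul1r.
have [d1 d1p h1] := h z (mem_head _ _).
have [z' z'rs|d2 d2p h2] := IH; first by apply: h; rewrite inE z'rs orbT.
exists (d1 * d2) => [|x]; first exact: mulr_gt0.
rewrite big_cons cpoly_opM//.
have -> y : cpoly_op ('X - z%:P) A y = A y - z *: y.
  have -> : 'X - z%:P = 1 * 'X + (- z)%:P :> {poly C} by rewrite mul1r polyCN.
  by rewrite cpoly_opMXD cpoly_opC scale1r scaleNr.
apply: le_trans (h1 _).
by rewrite -mulrA ler_pM2l.
Qed.

Lemma selfadjoint_real A x : selfadjoint A -> complex.Im (hdot (A x) x) = 0.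
Proof.
move=> sA; have := sA x x; rewrite [RHS]hdotC.
case: (hdot _ _) => a b /= [] h; lra.
Qed.

(** A bounded inverse of [A - z] would make it bounded below. As for realness, [|(A - z) x| |x|]
    dominates the imaginary part of [<(A - z) x, x>], which is [- Im z |x|^2] because [<A x, x>] is
    real. *)
Lemma not_bounded_below_spectrum A (z : C) : bounded_op A -> selfadjoint A ->
  ~ bounded_below (fun x => A x - z *: x) ->
  z = (complex.Re z)%:C%C /\ spectrum A z.
Proof.
move=> bA sA nb; split; last first.
  move=> [B [bB h1 _]]; apply: nb.
  have [M Mp [_ hM]] := bounded_bound bB.
  exists M^-1 => [|x]; first by rewrite invr_gt0.
  by rewrite ler_pdivrMl// -{1}(h1 x).
have [Im0|Im0] := eqVneq (complex.Im z) 0.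
  by move: Im0; case: (z) => a b /= ->.
case: nb; exists `|complex.Im z| => [|x]; first by rewrite normr_gt0.
have [->|x0] := eqVneq x 0; first by rewrite rnorm0 mulr0 rnorm_ge0.
have xp : 0 < rnorm x by rewrite rnorm_gt0.
rewrite -(ler_pM2r xp); apply: le_trans (CauchySchwarz _ _).
rewrite -mulrA -expr2 -[rnorm x ^+ 2]ger0_norm ?sqr_ge0// -normrM.
have -> : complex.Im z * rnorm x ^+ 2 = - complex.Im (hdot (A x - z *: x) x).
  rewrite hdotBl hdotZl hdotxx raddfB /= selfadjoint_real//.
  by case: (z) => a b /=; ring.
rewrite normrN -(@ler_pXn2r _ 2) ?nnegrE ?rnorm_ge0//.
by rewrite rnorm_sqr real_normK ?num_real// lerDr sqr_ge0.
Qed.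

Lemma root_in_spectrum A (P : {poly C}) : bounded_op A -> selfadjoint A ->
  P != 0 -> ~ bounded_below (cpoly_op P A) ->
  exists2 t : R, spectrum A t%:C%C & root P t%:C%C.
Proof.
move=> bA sA P0 nb.
have [rs PE] := closed_field_poly_normal P.
have [h|] := pselect (forall z, z \in rs -> bounded_below (fun x => A x - z *: x)).
  case: nb; have [d dp hd] := bounded_below_prod bA h.
  have lp : 0 < rnorm (lead_coef P).
    by rewrite lt_neqAle eq_sym rnorm_eq0 lead_coef_eq0 P0 rnorm_ge0.
  exists (rnorm (lead_coef P) * d) => [|x]; first exact: mulr_gt0.
  rewrite PE cpoly_opZ rnormZ lead_coefZ (monicP (monic_prod_XsubC _ _ _)) mulr1.
  by rewrite -mulrA ler_pM2l.
move=> /existsNP[z /not_implyP[zrs nbz]].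
have [zE sz] := not_bounded_below_spectrum bA sA nbz.
exists (complex.Re z); rewrite -?zE//.
by rewrite PE rootZ ?lead_coef_eq0// root_prod_XsubC.
Qed.

(** Let [a] be the norm of [S] and suppose [|S^2 x - a^2 x| >= d |x|]. Expanding the square and
    using [|S^2 x| <= a |S x|] gives [a^2 |S x|^2 <= (a^4 - d^2) |x|^2], so [S] would have a bound
    smaller than [a]. The non-zero vector excludes the zero space, on which every operator is
    bounded below. *)
Lemma selfadjoint_norm S : bounded_op S -> selfadjoint S ->
  (exists x : H, x != 0) ->
  exists a : R, [/\ 0 <= a, forall x, rnorm (S x) <= a * rnorm x &
    ~ bounded_below (fun x => S (S x) - (a ^+ 2)%:C%C *: x)].
Proof.
move=> bS sS [x0 x0n0]; have lS := bounded_lin bS.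
have [M Mp [M0 hM]] := bounded_bound bS.
set D := [set rnorm (S x) | x in [set x | rnorm x <= 1]].
have Dsup : has_sup D.
  split; first by exists (rnorm (S 0)), 0 => //=; rewrite rnorm0.
  exists M => _ [x /= x1 <-]; apply: le_trans (hM x) _.
  by rewrite ler_piMr.
set a := sup D.
have a0 : 0 <= a.
  by apply: ub_le_sup; [case: Dsup|exists 0; rewrite /= ?rnorm0// lin0// rnorm0].
have ha x : rnorm (S x) <= a * rnorm x.
  have [->|xn0] := eqVneq x 0; first by rewrite lin0// rnorm0 mulr0.
  have xp : 0 < rnorm x by rewrite rnorm_gt0.
  have ip : 0 <= (rnorm x)^-1 by rewrite invr_ge0 ltW.
  have : rnorm (S ((rnorm x)^-1%:C%C *: x)) <= a.
    apply: ub_le_sup; first by case: Dsup.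
    exists ((rnorm x)^-1%:C%C *: x) => //=.
    by rewrite rnormRZ ger0_norm// mulVf// gt_eqF.
  by rewrite linZ// rnormRZ ger0_norm// ler_pdivrMl// mulrC.
exists a; split=> //; case=> d dp hd.
have key x : a ^+ 2 * rnorm (S x) ^+ 2 <= (a ^+ 4 - d ^+ 2) * rnorm x ^+ 2.
  have h1 : (d * rnorm x) ^+ 2 <= rnorm (S (S x) - (a ^+ 2)%:C%C *: x) ^+ 2.
    rewrite ler_pXn2r ?nnegrE ?mulr_ge0 ?rnorm_ge0 ?(ltW dp)//.
  have h2 : rnorm (S (S x)) ^+ 2 <= (a * rnorm (S x)) ^+ 2.
    by rewrite ler_pXn2r ?nnegrE ?mulr_ge0 ?rnorm_ge0.
  move: h1; rewrite rnormB_sqr rdotZr rnormRZ !exprMn real_normK ?num_real//.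
  have -> : rdot (S (S x)) x = rnorm (S x) ^+ 2 by rewrite /rdot sS -/(rdot _ _) rdotxx.
  rewrite !exprMn in h2 *; lra.
have [a00|an0] := eqVneq a 0.
  have xp : 0 < rnorm x0 by rewrite rnorm_gt0.
  have := key x0; rewrite a00 !expr0n /= mul0r sub0r mulNr oppr_ge0.
  by rewrite leNgt mulr_gt0// exprn_gt0.
have ap : 0 < a by rewrite lt_neqAle eq_sym an0.
(* [Num.max 0] covers the case [a^4 < d^2], in which [key] forces [S x = 0]. *)
set b := Num.sqrt (Num.max 0 (a ^+ 2 - d ^+ 2 / a ^+ 2)).
have : a <= b.
  apply: ge_sup; first by case: Dsup.
  move=> _ [x /= x1 <-]; rewrite -(sqr_sqrtr (rnorm_ge0 (S x))) sqr_sqrtr ?rnorm_ge0//.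
  rewrite -[leLHS]ger0_norm ?rnorm_ge0// -sqrtr_sqr ler_wsqrtr//.
  rewrite -(@ler_pM2l _ (a ^+ 2)) ?exprn_gt0//.
  apply: (le_trans (key x)).
  have [h|h] := leP (a ^+ 4 - d ^+ 2) 0.
    apply: (@le_trans _ _ 0); first by rewrite mulr_le0_ge0// sqr_ge0.
    by rewrite mulr_ge0 ?sqr_ge0// le_max lexx.
  apply: (@le_trans _ _ (a ^+ 4 - d ^+ 2)).
    by rewrite ler_piMr ?(ltW h)// exprn_ile1 ?rnorm_ge0.
  apply: (@le_trans _ _ (a ^+ 2 * (a ^+ 2 - d ^+ 2 / a ^+ 2))).
    by rewrite le_eqVlt; apply/orP; left; apply/eqP; field.
  by rewrite ler_pM2l ?exprn_gt0// le_max lexx orbT.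
apply/negP; rewrite -ltNge -[ltRHS]ger0_norm// -sqrtr_sqr ltr_sqrt ?exprn_gt0//.
by rewrite gt_max exprn_gt0//= ltrBlDr ltrDl divr_gt0// exprn_gt0.
Qed.

Lemma poly_opE (q : {poly R}) A : poly_op q A = cpoly_op (map_poly (real_complex R) q) A.
Proof.
apply/funext => x; rewrite /poly_op /cpoly_op size_map_poly.
by apply: eq_bigr => i _; rewrite coef_map.
Qed.

Lemma bounded_poly (q : {poly R}) A : bounded_op A -> bounded_op (poly_op q A).
Proof. by rewrite poly_opE; exact: bounded_cpoly. Qed.

Lemma poly_opD (p q : {poly R}) A x : poly_op (p + q) A x = poly_op p A x + poly_op q A x.
Proof. by rewrite !poly_opE rmorphD cpoly_opD. Qed.

Lemma poly_opC (c : R) A x : poly_op c%:P A x = c%:C%C *: x.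
Proof. by rewrite !poly_opE map_polyC cpoly_opC. Qed.

Lemma poly_opZ (c : R) (q : {poly R}) A x : poly_op (c *: q) A x = c%:C%C *: poly_op q A x.
Proof. by rewrite !poly_opE map_polyZ cpoly_opZ. Qed.

Lemma poly_opN (p : {poly R}) A x : poly_op (- p) A x = - poly_op p A x.
Proof. by rewrite -scaleN1r poly_opZ rmorphN1 scaleN1r. Qed.

Lemma poly_opB (p q : {poly R}) A x : poly_op (p - q) A x = poly_op p A x - poly_op q A x.
Proof. by rewrite poly_opD poly_opN. Qed.

Lemma poly_opX A x : poly_op 'X A x = A x.
Proof.
by rewrite !poly_opE map_polyX -[X in cpoly_op X]mul1r cpoly_opMX cpoly_opC scale1r.
Qed.

Lemma poly_opM (p q : {poly R}) A x : bounded_op A ->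
  poly_op (p * q) A x = poly_op p A (poly_op q A x).
Proof. by move=> bA; rewrite !poly_opE rmorphM cpoly_opM. Qed.

Lemma poly_op_selfadjoint (q : {poly R}) A : bounded_op A -> selfadjoint A ->
  selfadjoint (poly_op q A).
Proof.
move=> bA sA; elim/poly_ind: q => [|q c IH] x y.
  by rewrite !poly_opC !scale0r hdot0l hdot0r.
rewrite !poly_opD !poly_opM// !poly_opC poly_opX hdotDl hdotDr.
rewrite IH -[in RHS]poly_opM// commr_polyX poly_opM// poly_opX sA.
by rewrite hdotZl hdotZr conjc_real.
Qed.

Lemma poly_op_eigen (q : {poly R}) A x (l : R) : bounded_op A -> A x = l%:C%C *: x ->
  poly_op q A x = q.[l]%:C%C *: x.
Proof.
move=> bA Ax; elim/poly_ind: q => [|q c IH].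
  by rewrite poly_opC horner0.
rewrite poly_opD poly_opC poly_opM// poly_opX Ax (linZ (bounded_lin (bounded_poly q bA))).
by rewrite IH scalerA !hornerE rmorphD rmorphM scalerDl mulrC.
Qed.

Lemma eigenvalue_spectrum A x (z : C) : bounded_op A -> x != 0 ->
  A x = z *: x -> spectrum A z.
Proof.
move=> bA x0 Ax [B [bB h _]]; move: x0.
by rewrite -(h x) Ax subrr (lin0 (bounded_lin bB)) eqxx.
Qed.

Lemma norm_poly_op A (q : {poly R}) (c : R) : bounded_op A -> selfadjoint A -> 0 <= c ->
  (forall t : R, spectrum A t%:C%C -> `|q.[t]| <= c) ->
  forall x, rnorm (poly_op q A x) <= c * rnorm x.
Proof.
move=> bA sA c0 hc x.
have [x0|x0] := eqVneq x 0.
  by rewrite x0 (lin0 (bounded_lin (bounded_poly q bA))) rnorm0 mulr0.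
have exn0 : exists x : H, x != 0 by exists x.
(* The polynomial [q^2 - a^2] below may vanish identically; any point is then a root, but one in the
   spectrum must exist. The same argument with [X^2 - a^2], which is never the zero polynomial,
   provides it. *)
have nonempty : exists t : R, spectrum A t%:C%C.
  have [a [a0 ha nb]] := selfadjoint_norm bA sA exn0.
  have [||t] := @root_in_spectrum A ('X * 'X - ((a ^+ 2)%:C%C)%:P) bA sA.
  - rewrite -expr2 -size_poly_eq0 size_addl ?size_polyXn// size_polyN.
    by rewrite (leq_ltn_trans (size_polyC_leq1 _)).
  - congr (~ _): nb; congr bounded_below; apply/funext => y.
    rewrite -polyCN cpoly_opMXD -['X]mul1r cpoly_opMX cpoly_opC scale1r.
    by rewrite scaleNr.
  by exists t.
have [a [a0 ha nb]] :=
  selfadjoint_norm (bounded_poly q bA) (poly_op_selfadjoint q bA sA) exn0.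
apply: (le_trans (ha x)); rewrite ler_wpM2r ?rnorm_ge0//.
set P := map_poly (real_complex R) (q * q - (a ^+ 2)%:P).
have [t st rt] : exists2 t : R, spectrum A t%:C%C & root P t%:C%C.
  have [P0|P0] := eqVneq P 0.
    by have [t st] := nonempty; exists t; rewrite // P0 root0.
  apply: root_in_spectrum => //.
  congr (~ _): nb; congr bounded_below; apply/funext => y.
  by rewrite -poly_opE poly_opB poly_opM// poly_opC.
move: rt; rewrite /P fmorph_root /root !hornerE -expr2 subr_eq0 => /eqP rt.
have -> : a = `|q.[t]| by rewrite -sqrtr_sqr rt sqrtr_sqr ger0_norm.
exact: hc.
Qed.

(** Being bounded below gives injectivity and a closed range; the orthogonal complement of the range
    of a selfadjoint operator is its kernel, so the range is everything. *)
Lemma selfadjoint_inverse S : bounded_op S -> selfadjoint S -> bounded_below S ->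
  exists B, [/\ bounded_op B, forall x, B (S x) = x & forall x, S (B x) = x].
Proof.
move=> bS sS [d dp hd]; have lS := bounded_lin bS.
have Sinj x y : S x = S y -> x = y.
  move=> Sxy; apply/eqP; rewrite -subr_eq0 -rnorm_eq0.
  have := hd (x - y); rewrite linB// Sxy subrr rnorm0 pmulr_rle0// => h.
  by rewrite eq_le h rnorm_ge0.
have surj y : exists x, S x = y.
  suff : range S y by move=> [x _ <-]; exists x.
  apply: orthogonal_complement_trivial.
  - split; first by exists 0; rewrite ?lin0.
    by move=> a _ _ [x _ <-] [z _ <-]; exists (a *: x + z); rewrite ?lS.
  - move=> {}y hy.
    have /choice[u hu] : forall n : nat, exists x, rnorm (y - S x) < n.+1%:R^-1.
      move=> n; have n0 : 0 < n.+1%:R^-1 :> R by rewrite invr_gt0 ltr0n.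
      by have [_ [x _ <-] h] := hy _ n0; exists x.
    have small (e : R) : 0 < e ->
        exists N : nat, forall n, (N <= n)%N -> rnorm (y - S (u n)) < e.
      move=> e0; exists (Num.bound e^-1) => n hn.
      apply: lt_trans (hu n) _.
      rewrite invf_plt ?posrE//.
      have /archi_boundP/lt_le_trans : 0 <= e^-1 by rewrite invr_ge0 ltW.
      by apply; rewrite ler_nat (leq_trans hn).
    have [e e0|l hl] := @seq_complete _ _ u.
      have [N hN] := small (d * e / 2) (divr_gt0 (mulr_gt0 dp e0) (ltr0n _ 2)).
      exists N => m n Nm Nn.
      rewrite -(ltr_pM2l dp); apply: (le_lt_trans (hd _)).
      rewrite linB//; apply: (le_lt_trans (rnorm_dist_trans y _ _)).
      by rewrite [ltRHS]splitr rnorm_distC ltrD// hN.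
    exists l => //; apply/eqP; rewrite -subr_eq0; apply/eqP.
    apply: rnorm_small => e e0.
    have [M Mp [_ hM]] := bounded_bound bS.
    have [N1 h1] := small _ (divr_gt0 e0 (ltr0n _ 2)).
    have [N2 h2] := hl _ (divr_gt0 (divr_gt0 e0 (ltr0n _ 2)) Mp).
    set n := maxn N1 N2.
    have h3 : rnorm (S (u n - l)) <= e / 2.
      apply: (le_trans (hM _)); rewrite -ler_pdivlMl// mulrC ltW// h2//.
      exact: leq_maxr.
    rewrite rnorm_distC (le_trans (rnorm_dist_trans (S (u n)) _ _))//.
    rewrite [leRHS]splitr lerD//; first by rewrite ltW// h1// leq_maxl.
    by rewrite -linB.
  - move=> z hz; apply: Sinj; rewrite lin0//; apply: hdot_ext => w.
    by rewrite hdot0r -sS hdotC hz ?rmorph0//; exists w.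
have /choice[B hB] := surj.
exists B; split=> // [|x]; last exact: Sinj.
apply: (@bound_bounded _ _ d^-1).
  by move=> a x y; apply: Sinj; rewrite lS !hB.
split=> [|x]; first by rewrite invr_ge0 ltW.
by rewrite ler_pdivlMl// -{2}(hB x).
Qed.

Lemma selfadjoint_shift A (t : R) : selfadjoint A ->
  selfadjoint (fun x => A x - t%:C%C *: x).
Proof.
by move=> sA x y; rewrite hdotBl hdotBr sA hdotZl hdotZr conjc_real.
Qed.

Lemma not_spectrum A (t : R) : bounded_op A -> selfadjoint A ->
  bounded_below (fun x => A x - t%:C%C *: x) -> ~ spectrum A t%:C%C.
Proof.
move=> bA sA bb; apply; have [||B [bB h1 h2]] := selfadjoint_inverse _ _ bb.
- rewrite (_ : (fun _ => _) = A \+ ((- t)%:C%C \*: id)).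
    exact: bounded_add bA (bounded_scale _ bounded_id).
  by apply/funext => x /=; rewrite rmorphN scaleNr.
- exact: selfadjoint_shift.
by exists B.
Qed.

(** Polarization: the form is real at [x + y] and at [x + i y], which gives [h1] and [h2]; their sum
    is twice the claim. *)
Lemma positive_selfadjoint A : positive_op A -> selfadjoint A.
Proof.
move=> [bA pA]; have lA := bounded_lin bA.
have real x : hdot (A x) x = hdot x (A x).
  rewrite [RHS]hdotC; have := pA x; case: (hdot _ _) => a b.
  by rewrite lecE /= => /andP[/eqP -> _]; rewrite oppr0.
move=> x y.
have h1 : hdot (A x) y + hdot (A y) x = hdot x (A y) + hdot y (A x).
  have := real (x + y); rewrite linD// !hdotDl !hdotDr (real x) (real y) => h.
  move/eqP: h; rewrite -subr_eq0 => /eqP h.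
  by apply/eqP; rewrite -subr_eq0 -h; apply/eqP; ring.
have h2 : hdot (A x) y - hdot (A y) x = hdot x (A y) - hdot y (A x).
  have := real (x + 'i%C *: y).
  rewrite linD// linZ// !hdotDl !hdotDr !hdotZl !hdotZr (real x) (real y).
  have -> : ('i%C : C)^*%C = - 'i%C by apply/eqP; rewrite eq_complex /= oppr0 !eqxx.
  set a := hdot x (A x); set b := hdot y (A y); set i : C := 'i%C => h.
  have i0 : i != 0 by rewrite eq_complex /= oner_eq0 andbF.
  apply/eqP; rewrite -subr_eq0 -(mulrI_eq0 _ (mulfI i0)) -oppr_eq0.
  move/eqP: h; rewrite -subr_eq0 => /eqP h; rewrite -h; apply/eqP; ring.
have : (2 : C) * hdot (A x) y = 2 * hdot x (A y).
  have -> : 2 * hdot (A x) y =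
      (hdot (A x) y + hdot (A y) x) + (hdot (A x) y - hdot (A y) x) by ring.
  by rewrite h1 h2; ring.
by apply: mulfI; rewrite pnatr_eq0.
Qed.

Lemma positive_ge0 A x : positive_op A -> 0 <= rdot (A x) x.
Proof. by move=> [_ /(_ x)]; rewrite lecE => /andP[]. Qed.

Lemma positiveP A : bounded_op A -> selfadjoint A ->
  (forall x, 0 <= rdot (A x) x) -> positive_op A.
Proof.
move=> bA sA h; split=> // x.
by rewrite lecE selfadjoint_real//= eqxx; apply: h.
Qed.

Lemma bounded_below_rdot S (d : R) : 0 < d ->
  (forall x, d * rnorm x ^+ 2 <= `|rdot (S x) x|) -> bounded_below S.
Proof.
move=> dp h; exists d => // x.
have [->|x0] := eqVneq x 0; first by rewrite rnorm0 mulr0 rnorm_ge0.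
have xp : 0 < rnorm x by rewrite rnorm_gt0.
rewrite -(ler_pM2r xp) -mulrA -expr2; apply: le_trans (h x) _.
exact: rdot_norm_le.
Qed.

(** For [t < 0] the form of [A - t] is at least [- t |x|^2], and for [t > M] it is at most
    [(M - t) |x|^2]; either way [A - t] is bounded below. *)
Lemma spectrum_positive A M (t : R) : positive_op A -> bound_op M A ->
  spectrum A t%:C%C -> 0 <= t <= M.
Proof.
move=> pA [M0 hM] st; have [bA _] := pA; have sA := positive_selfadjoint pA.
rewrite !leNgt; apply/andP; split; apply/negP => ht; apply: not_spectrum st => //.
  apply: (@bounded_below_rdot _ (- t)); first by rewrite oppr_gt0.
  move=> x; rewrite rdotBl rdotZl rdotxx; apply: le_trans (ler_norm _).
  by have := positive_ge0 x pA; lra.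
apply: (@bounded_below_rdot _ (t - M)); first by rewrite subr_gt0.
move=> x; rewrite rdotBl rdotZl rdotxx -normrN; apply: le_trans (ler_norm _).
have : rdot (A x) x <= M * rnorm x * rnorm x.
  by apply: le_trans (rdot_le _ _) _; rewrite ler_wpM2r ?rnorm_ge0.
lra.
Qed.

End PolynomialCalculus.
(** * Weierstrass approximation *)

Section Weierstrass.
Context {R : realType}.
Implicit Types (phi : R -> R) (x y s t e K M : R).

Definition cont_nonneg phi := forall s e, 0 <= s -> 0 < e ->
  exists2 d, 0 < d & forall u, 0 <= u -> `|u - s| < d -> `|phi u - phi s| < e.

Lemma within_cont_nonneg phi :
  {within `[0, +oo[, continuous phi} -> cont_nonneg phi.
Proof.
move=> /subspace_continuousP h s e s0 e0.
have /h : `[0, +oo[%classic s by rewrite /= in_itv /= s0.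
move=> /cvgrPdist_lt /(_ e e0); rewrite near_withinE => /nbhs_ballP[d /= d0 hd].
exists d => // u u0 us; rewrite distrC; apply: hd; last by rewrite /= in_itv /= u0.
by rewrite /ball /= distrC.
Qed.

(** Finite subcovers, in the form shared by [cont_bounded] and [cont_quadratic]; monotonicity in [n]
    merges the local indices into one. *)
Lemma compact_uniform M (P : nat -> R -> Prop) :
  (forall n m s, (n <= m)%N -> P n s -> P m s) ->
  (forall s, 0 <= s <= M -> exists n, exists2 d, 0 < d &
    forall u, 0 <= u <= M -> `|u - s| < d -> P n u) ->
  exists n, forall s, 0 <= s <= M -> P n s.
Proof.
move=> mono loc.
have /compact_near_coveringP cov := @segment_compact R 0 M.
have := cov nat \oo (fun n s => 0 <= s <= M -> P n s) _ _.
case=> [s|N _ hN]; last first.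
  exists N => s sM; apply: (hN N (leqnn N) s) => //.
rewrite /= in_itv /= => /loc[n [d d0 hd]].
exists (ball s d, [set m | (n <= m)%N]); first by split; [exact: nbhsx_ballx|exists n].
move=> [u m] /= [us nm] uM; apply: mono nm _; apply: hd => //.
by rewrite distrC.
Qed.

Lemma cont_bounded phi M : cont_nonneg phi ->
  exists2 c, 0 <= c & forall s, 0 <= s <= M -> `|phi s| <= c.
Proof.
move=> cphi.
have [||n hn] := @compact_uniform M (fun n s => `|phi s| <= n%:R).
- by move=> n m s nm /le_trans; apply; rewrite ler_nat.
- move=> s /andP[s0 sM]; have [d d0 hd] := cphi s 1 s0 ltr01.
  exists (Num.bound (`|phi s| + 1)); exists d => // u /andP[u0 _] us.
  have h1 : `|phi s| + 1 < (Num.bound (`|phi s| + 1))%:R.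
    by apply: archi_boundP; rewrite addr_ge0.
  have h2 := lerB_dist (phi u) (phi s).
  have h3 := hd u u0 us; lra.
by exists n%:R.
Qed.

(* Uniform continuity in the quadratic form matching the variance estimate. *)
Lemma cont_quadratic phi M e : cont_nonneg phi -> 0 < e ->
  exists2 K, 0 <= K & forall s t, 0 <= s <= M -> 0 <= t <= M ->
    `|phi s - phi t| <= e + K * (s - t) ^+ 2.
Proof.
move=> cphi e0; have [c c0 hc] := @cont_bounded phi M cphi.
have [||n hn] := @compact_uniform M (fun n s => forall t, 0 <= t <= M ->
    `|phi s - phi t| <= e + n%:R * (s - t) ^+ 2).
- move=> n m s nm h t tM; apply: (le_trans (h t tM)).
  by rewrite lerD2l ler_wpM2r ?sqr_ge0// ler_nat.
- move=> s /andP[s0 sM]; have [d d0 hd] := cphi s (e / 2) s0 (divr_gt0 e0 (ltr0n _ 2)).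
  (* If [t] is at least [d] away from [s], then [|u - t| >= d / 2] and [k (u - t)^2 >= 2 c], which
     covers any difference of two values of [phi]. *)
  set k := 2 * c / (d / 2) ^+ 2.
  have d20 : 0 < d / 2 by rewrite divr_gt0.
  have k0 : 0 <= k by rewrite divr_ge0 ?sqr_ge0// mulr_ge0.
  exists (Num.bound k); exists (d / 2) => // u uM us t tM.
  have kb : k < (Num.bound k)%:R by exact: archi_boundP.
  have [u0 _] := andP uM; have [t0 _] := andP tM.
  have [td|td] := ltP `|t - s| d.
    have h1 := hd t t0 td.
    have h2 : `|phi u - phi s| < e / 2 by apply: hd => //; lra.
    apply: (@le_trans _ _ e); last by rewrite lerDl mulr_ge0 ?sqr_ge0.
    have -> : phi u - phi t = (phi u - phi s) - (phi t - phi s) by ring.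
    apply: (le_trans (ler_normB _ _)); lra.
  have hut : d / 2 <= `|u - t|.
    have : `|t - s| <= `|u - s| + `|u - t|.
      have -> : t - s = (u - s) - (u - t) by ring.
      exact: ler_normB.
    lra.
  apply: (@le_trans _ _ (2 * c)).
    by apply: (le_trans (ler_normB _ _)); rewrite mulr_natl mulr2n lerD ?hc.
  apply: (@le_trans _ _ (k * (u - t) ^+ 2)); last first.
    apply: (@le_trans _ _ ((Num.bound k)%:R * (u - t) ^+ 2)).
      by rewrite ler_wpM2r ?sqr_ge0// ltW.
    by rewrite lerDr ltW.
  rewrite /k mulrAC ler_pdivlMr ?exprn_gt0//.
  rewrite ler_wpM2l ?mulr_ge0// -[leRHS]real_normK ?num_real//.
  by rewrite ler_pXn2r ?nnegrE// ltW.
by exists n%:R => // s t sM tM; apply: hn.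
Qed.

(* Evaluated at [x], the expectation of [h] under the binomial law [B(n, x)]. *)
Fixpoint bernstein (n : nat) (h : nat -> R) : {poly R} :=
  if n is n'.+1 then
    (1 - 'X) * bernstein n' h + 'X * bernstein n' (fun k => h k.+1)
  else (h 0%N)%:P.

(** Induction by conditioning on one trial: a success shifts the count [k] by one, that is, the
    centre [c] becomes [c - 1], so [c] has to be general. The factor of [K] in the conclusion is the
    mean of [(k - c)^2], variance plus squared bias. *)
Lemma bernstein_approx n (h : nat -> R) (v e K c x : R) : 0 <= x <= 1 ->
  (forall k, (k <= n)%N -> `|h k - v| <= e + K * (k%:R - c) ^+ 2) ->
  `|(bernstein n h).[x] - v| <=
    e + K * (n%:R * x * (1 - x) + (n%:R * x - c) ^+ 2).
Proof.
move=> /andP[x0 x1]; elim: n h c => [|n IH] h c hh /=.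
  by rewrite hornerC !mul0r add0r; apply: hh.
rewrite !hornerE.
have h1 := IH h c (fun k kn => hh k (leqW kn)).
have h2 : `|(bernstein n (fun k => h k.+1)).[x] - v| <=
    e + K * (n%:R * x * (1 - x) + (n%:R * x - (c - 1)) ^+ 2).
  apply: IH => k kn; have := hh k.+1 kn.
  have -> : k.+1%:R - c = k%:R - (c - 1) by rewrite -natr1; ring.
  by [].
set a := (bernstein n h).[x] in h1 *.
set b := (bernstein n _).[x] in h2 *.
have -> : (1 - x) * a + x * b - v = (1 - x) * (a - v) + x * (b - v) by ring.
apply: (le_trans (ler_normD _ _)); rewrite !normrM (ger0_norm x0).
rewrite (@ger0_norm _ (1 - x)) ?subr_ge0//.
have x1' : 0 <= 1 - x by rewrite subr_ge0.
have := lerD (ler_wpM2l x1' h1) (ler_wpM2l x0 h2).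
move=> /le_trans; apply; rewrite le_eqVlt; apply/orP; left; apply/eqP.
by rewrite -natr1; ring.
Qed.

Lemma weierstrass phi M e : cont_nonneg phi -> 0 < M -> 0 < e ->
  exists q : {poly R}, forall t, 0 <= t <= M -> `|q.[t] - phi t| <= e.
Proof.
move=> cphi M0 e0.
have e20 : 0 < e / 2 by rewrite divr_gt0.
have [K K0 hK] := @cont_quadratic phi M (e / 2) cphi e20.
(* This size of [n] makes [K M^2 / n <= e / 2]. *)
have [n n0 hn] : exists2 n : nat, 0 < n%:R :> R & 2 * K * M ^+ 2 / e <= n%:R.
  exists (Num.bound (2 * K * M ^+ 2 / e)).+1; first by rewrite ltr0n.
  have /archi_boundP/ltW/le_trans : 0 <= 2 * K * M ^+ 2 / e.
    by rewrite divr_ge0 ?(ltW e0)// mulr_ge0 ?sqr_ge0// mulr_ge0.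
  by apply; rewrite ler_nat.
exists (bernstein n (fun k => phi (M * k%:R / n%:R)) \Po (M^-1 *: 'X)) => t /andP[t0 tM].
rewrite horner_comp !hornerE; set x := M^-1 * t.
have tE : t = M * x by rewrite /x mulrA divff ?mul1r// gt_eqF.
have x01 : 0 <= x <= 1.
  apply/andP; split; first by rewrite mulr_ge0// invr_ge0 ltW.
  by rewrite ler_pdivrMl// mulr1.
(* With the mean [n x] as centre only the variance [n x (1 - x)] remains. The factor [M^2 / n^2]
   comes from [M k / n - M x = (M / n) (k - n x)]. *)
have := @bernstein_approx n (fun k => phi (M * k%:R / n%:R)) (phi t) (e / 2)
  (K * M ^+ 2 / n%:R ^+ 2) (n%:R * x) x x01.
move=> h; apply: (le_trans (h _)) => {h}.
  move=> k kn; apply: (le_trans (hK _ t _ _)); last 2 first.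
  - by rewrite t0.
  - rewrite lerD2l le_eqVlt; apply/orP; left; apply/eqP.
    by rewrite tE; field; rewrite gt_eqF.
  apply/andP; split; first by rewrite divr_ge0 ?mulr_ge0 ?(ltW M0) ?(ltW n0).
  by rewrite ler_pdivrMr// ler_wpM2l ?(ltW M0)// ler_nat.
rewrite subrr expr0n addr0 [leRHS]splitr lerD2l.
have -> : K * M ^+ 2 / n%:R ^+ 2 * (n%:R * x * (1 - x)) =
    K * M ^+ 2 / n%:R * (x * (1 - x)) by field; rewrite gt_eqF.
apply: (@le_trans _ _ (K * M ^+ 2 / n%:R)).
  have [y0 y1] := andP x01.
  by rewrite ler_piMr ?divr_ge0 ?mulr_ge0 ?sqr_ge0 ?(ltW n0)//; nra.
rewrite ler_pdivrMr//; move: hn; rewrite ler_pdivrMr// => hn.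
by rewrite -(@ler_pM2l _ 2)//; lra.
Qed.

End Weierstrass.
(** * Continuous functional calculus *)

Section FunctionalCalculus.
Context {R : realType} {H : hilbertType R}.
Local Notation C := R[i]%C.
Implicit Types (S T A B D : H -> H) (x y : H) (phi psi : R -> R) (p q : {poly R}).

(** Equivalent to [is_cfc] for bounded [A], but free of sequences: one polynomial is close both to
    [phi] on the spectrum and to [B] in norm, so approximants of two functions can be subtracted or
    multiplied. *)
Definition cfc_approx phi A B := bounded_op B /\
  forall e : R, 0 < e -> exists2 q : {poly R},
    forall t : R, spectrum A t%:C%C -> `|q.[t] - phi t| <= e &
    forall x, rnorm (poly_op q A x - B x) <= e * rnorm x.

Lemma lin_sub S T : linear S -> linear T -> linear (S \- T).
Proof.
move=> lS lT a x y /=; rewrite lS lT scalerBr opprD.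
by rewrite addrACA.
Qed.

Lemma opnorm_ge0 T : linear T -> (0 <= opnorm T)%E.
Proof.
move=> lT; apply: ereal_sup_ubound; exists 0 => /=; last by rewrite lin0// normr0.
by rewrite normr0 ler01.
Qed.

Lemma is_cfcP phi A B : bounded_op A -> is_cfc phi A B <-> cfc_approx phi A B.
Proof.
move=> bA; split=> -[bB].
  move=> [q [qphi qB]]; split=> // e e0.
  have [N1 _ h1] : \forall n \near \oo, forall t : R, spectrum A t%:C%C ->
      `|(q n).[t] - phi t| < e.
    apply: (qphi [set g : R -> R | forall t, spectrum A t%:C%C -> `|g t - phi t| < e]).
    apply/uniform_nbhs; exists [set xy | ball xy.1 (PosNum e0)%:num xy.2].
    split; first exact: entourage_ball.
    by move=> g /= hg t /hg; rewrite /ball /= distrC.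
  have [N2 _ h2] : \forall n \near \oo, (opnorm (poly_op (q n) A \- B)%R < e%:E)%E.
    exact: (qB _ (@nbhs_open_ereal_lt _ 0 (fun=> e) e0)).
  set n := maxn N1 N2; exists (q n) => [t st|].
    by apply/ltW/h1 => //=; exact: leq_maxl.
  apply/opnorm_le; rewrite ?(ltW e0)//.
    exact: lin_sub (bounded_lin (bounded_poly _ bA)) (bounded_lin bB).
  by apply/ltW/h2 => /=; exact: leq_maxr.
move=> h; split=> //.
have /choice[q hq] : forall n : nat, exists q : {poly R},
    (forall t : R, spectrum A t%:C%C -> `|q.[t] - phi t| <= n.+1%:R^-1) /\
    (forall x, rnorm (poly_op q A x - B x) <= n.+1%:R^-1 * rnorm x).
  move=> n; have n0 : 0 < n.+1%:R^-1 :> R by rewrite invr_gt0 ltr0n.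
  by have [q h1 h2] := h _ n0; exists q.
exists q; split.
  move=> P /uniform_nbhs[E [entE subP]].
  move: entE; rewrite -entourage_ballE => -[e /= e0 eE].
  have [N _ hN] := @cvgr0_norm_lt _ _ _ _ _ _ (@cvg_harmonic R) _ e0.
  exists N => // n /= Nn; apply: subP => t st; apply: eE => /=.
  rewrite /ball /= distrC; apply: le_lt_trans ((hq n).1 t st) _.
  by have := hN n Nn; rewrite /harmonic /= ger0_norm.
apply: (@squeeze_cvge _ _ _ _ (cst 0%E) _ (fun n => (n.+1%:R^-1)%:E)).
- near=> n; apply/andP; split.
    apply: opnorm_ge0.
    exact: lin_sub (bounded_lin (bounded_poly _ bA)) (bounded_lin bB).
  apply/opnorm_le => //; last exact: (hq n).2.
  exact: lin_sub (bounded_lin (bounded_poly _ bA)) (bounded_lin bB).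
- exact: cvg_cst.
- by apply: cvg_EFin; [near=> n|exact: cvg_harmonic].
Unshelve. all: by end_near. Qed.

(** Polynomials within [1 / (n + 1)] of [phi] on an interval containing the spectrum give, by
    [norm_poly_op], operators that are Cauchy in norm; [B] is their pointwise limit. *)
Lemma cfc_exists phi A : positive_op A -> cont_nonneg phi ->
  exists B, cfc_approx phi A B.
Proof.
move=> pA cphi; have [bA _] := pA; have sA := positive_selfadjoint pA.
have [M Mp hM] := bounded_bound bA.
have spM t : spectrum A t%:C%C -> 0 <= t <= M by apply: spectrum_positive.
have /choice[q hq] : forall n : nat, exists q : {poly R},
    forall t : R, spectrum A t%:C%C -> `|q.[t] - phi t| <= n.+1%:R^-1.
  move=> n; have n0 : 0 < n.+1%:R^-1 :> R by rewrite invr_gt0 ltr0n.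
  by have [q h] := weierstrass cphi Mp n0; exists q => t /spM /h.
have dist m n x : rnorm (poly_op (q m) A x - poly_op (q n) A x) <=
    (m.+1%:R^-1 + n.+1%:R^-1) * rnorm x.
  rewrite -poly_opB; apply: norm_poly_op => //.
  move=> t st; rewrite hornerD hornerN.
  have -> : (q m).[t] - (q n).[t] = ((q m).[t] - phi t) - ((q n).[t] - phi t) by ring.
  by apply: (le_trans (ler_normB _ _)); rewrite lerD// hq.
have small (e : R) : 0 < e -> exists N : nat, forall n, (N <= n)%N -> n.+1%:R^-1 < e.
  move=> e0; have [N _ hN] := @cvgr0_norm_lt _ _ _ _ _ _ (@cvg_harmonic R) _ e0.
  by exists N => n Nn; have := hN n Nn; rewrite /harmonic /= ger0_norm.
have /choice[B hB] x : exists l, slim (fun n => poly_op (q n) A x) l.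
  apply: seq_complete => e e0.
  have rp : 0 < rnorm x + 1 by rewrite ltr_wpDl ?rnorm_ge0.
  have [N hN] := small (e / (2 * (rnorm x + 1))) (divr_gt0 e0 (mulr_gt0 (ltr0n _ 2) rp)).
  exists N => m n Nm Nn; apply: le_lt_trans (dist m n x) _.
  have h1 := hN m Nm; have h2 := hN n Nn.
  apply: (@le_lt_trans _ _ ((m.+1%:R^-1 + n.+1%:R^-1) * (rnorm x + 1))).
    by rewrite ler_wpM2l ?addr_ge0// lerDl.
  rewrite -ltr_pdivlMr//.
  have -> : e / (rnorm x + 1) = e / (2 * (rnorm x + 1)) + e / (2 * (rnorm x + 1)).
    by field; rewrite gt_eqF.
  by rewrite ltrD.
(* Letting [m] tend to infinity in [dist] removes the term in [m] and keeps the rate in [n]. *)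
have hqB n x : rnorm (poly_op (q n) A x - B x) <= n.+1%:R^-1 * rnorm x.
  apply: le_eps => e e0.
  have rp : 0 < rnorm x + 1 by rewrite ltr_wpDl ?rnorm_ge0.
  have e20 : 0 < e / 2 by rewrite divr_gt0.
  have [N1 h1] := small (e / 2 / (rnorm x + 1)) (divr_gt0 e20 rp).
  have [N2 h2] := hB x _ e20.
  set m := maxn N1 N2.
  apply: le_trans (rnorm_dist_trans (poly_op (q m) A x) _ _) _.
  apply: le_trans (lerD (dist n m x) (ltW (h2 m (leq_maxr _ _)))) _.
  have : m.+1%:R^-1 * rnorm x <= e / 2.
    have := h1 m (leq_maxl _ _); rewrite ltr_pdivlMr// => /ltW; apply: le_trans.
    by rewrite ler_wpM2l// lerDl.
  by rewrite mulrDl; move: (_^-1 * _) (_^-1 * _) => a b; lra.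
exists B; split; last first.
  move=> e e0; have [N hN] := small e e0; exists (q N) => [t st|x].
    exact: le_trans (hq N t st) (ltW (hN N (leqnn N))).
  by apply: le_trans (hqB N x) _; rewrite ler_wpM2r ?rnorm_ge0// ltW// hN.
have [K Kp [K0 hK]] := bounded_bound (bounded_poly (q 0%N) bA).
apply: (@bound_bounded _ _ (K + 1)); last first.
  split=> [|x]; first by rewrite addr_ge0.
  have -> : B x = poly_op (q 0%N) A x - (poly_op (q 0%N) A x - B x).
    by rewrite opprB addrC subrK.
  apply: le_trans (rnormB _ _) _; rewrite mulrDl lerD//.
  by apply: le_trans (hqB _ _) _; rewrite invr1.
(* Linearity survives the limit: the defect of [B] is a combination of three errors of [q N] at [x],
   [y] and [a x + y]. *)
move=> a x y; apply/eqP; rewrite -subr_eq0; apply/eqP/rnorm_small => e e0.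
set s := rnorm (a *: x + y) + rnorm a * rnorm x + rnorm y + 1.
have s0 : 0 < s by rewrite ltr_wpDl// !addr_ge0 ?mulr_ge0 ?rnorm_ge0.
have [N hN] := small (e / s) (divr_gt0 e0 s0).
have {}hN := ltW (hN N (leqnn N)).
have lN := bounded_lin (bounded_poly (q N) bA).
have -> : B (a *: x + y) - (a *: B x + B y) =
   a *: (poly_op (q N) A x - B x) + (poly_op (q N) A y - B y)
   - (poly_op (q N) A (a *: x + y) - B (a *: x + y)).
  have idP (P Q U V W : H) : W - (U + V) = P - U + (Q - V) - (P + Q - W).
    by rewrite addrACA -opprD opprB [RHS]addrC addrA subrK.
  by rewrite lN scalerBr; exact: idP.
apply: le_trans (rnormB _ _) _.
apply: (@le_trans _ _ (N.+1%:R^-1 * s)).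
  apply: le_trans (lerD (rnormD _ _) (hqB _ _)) _; rewrite rnormZ.
  apply: le_trans (lerD (lerD (ler_wpM2l (rnorm_ge0 _) (hqB _ _)) (hqB _ _)) (lexx _)) _.
  have : 0 <= N.+1%:R^-1 :> R by [].
  rewrite /s; move: (N.+1%:R^-1 : R) (rnorm a) (rnorm x) (rnorm y) (rnorm _).
  move=> k u v w z k0; rewrite -subr_ge0.
  by rewrite (_ : _ - _ = k)//; ring.
by rewrite -ler_pdivlMr.
Qed.

Lemma cfcP phi A : positive_op A -> cont_nonneg phi ->
  cfc_approx phi A (cfc phi A).
Proof.
move=> pA cphi; have [bA _] := pA.
have [B hB] := cfc_exists pA cphi.
apply/is_cfcP => //.
suff : is_cfc phi A `<=` is_cfc phi A /\ (is_cfc phi A) (cfc phi A) by case.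
split=> //; apply: xgetPex.
by exists B; apply/is_cfcP.
Qed.

Section Properties.
Variables (A : H -> H).
Hypotheses (bA : bounded_op A) (sA : selfadjoint A).

Lemma cfc_approx_norm phi B (c : R) : cfc_approx phi A B -> 0 <= c ->
  (forall t : R, spectrum A t%:C%C -> `|phi t| <= c) ->
  forall x, rnorm (B x) <= c * rnorm x.
Proof.
move=> [bB hB] c0 hc x; apply: le_eps => e e0.
have rp : 0 < rnorm x + 1 by rewrite ltr_wpDl ?rnorm_ge0.
set d := e / (2 * (rnorm x + 1)).
have dp : 0 < d by rewrite divr_gt0// mulr_gt0.
have [q h1 h2] := hB d dp.
have h3 : rnorm (poly_op q A x) <= (c + d) * rnorm x.
  apply: norm_poly_op => //; first by rewrite addr_ge0// ltW.
  move=> t st; have := lerD (hc t st) (h1 t st); apply: le_trans.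
  by rewrite -{1}(subrK (phi t) q.[t]) addrC ler_normD.
have h4 : rnorm (B x) <= rnorm (poly_op q A x) + rnorm (poly_op q A x - B x).
  by rewrite -{1}[B x](subKr (poly_op q A x)) rnormB.
have h5 := h2 x.
have h6 : d * rnorm x <= e / 2.
  rewrite /d invfM mulrA -mulrA ler_piMr ?divr_ge0 ?(ltW e0)//.
  by rewrite mulrC ler_pdivrMr// mul1r lerDl.
lra.
Qed.

Lemma cfc_approx_poly q : cfc_approx (horner q) A (poly_op q A).
Proof.
split; first exact: bounded_poly.
move=> e e0; exists q => [t _|x]; first by rewrite subrr normr0 ltW.
by rewrite subrr rnorm0 mulr_ge0 ?rnorm_ge0// ltW.
Qed.

Lemma cfc_approx_sub phi psi B D : cfc_approx phi A B -> cfc_approx psi A D ->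
  cfc_approx (phi \- psi) A (B \- D).
Proof.
move=> [bB hB] [bD hD]; split.
  rewrite (_ : B \- D = B \+ ((-1) \*: D)); last first.
    by apply/funext => x /=; rewrite scaleN1r.
  exact: bounded_add bB (bounded_scale _ bD).
move=> e e0; have e20 : 0 < e / 2 by rewrite divr_gt0.
have [q1 h1 k1] := hB _ e20; have [q2 h2 k2] := hD _ e20.
exists (q1 - q2) => [t st|x].
  rewrite hornerD hornerN /=.
  have -> : q1.[t] - q2.[t] - (phi t - psi t) = (q1.[t] - phi t) - (q2.[t] - psi t) by ring.
  by apply: le_trans (ler_normB _ _) _; rewrite [e]splitr lerD ?h1 ?h2.
rewrite poly_opB /=.
have -> : poly_op q1 A x - poly_op q2 A x - (B x - D x) =
    (poly_op q1 A x - B x) - (poly_op q2 A x - D x).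
  by rewrite !opprB addrACA [RHS]addrACA; congr (_ + _); exact: addrC.
apply: le_trans (rnormB _ _) _; rewrite [e]splitr mulrDl lerD//.
Qed.

(** The difference represents a function that vanishes on the spectrum, so its norm is 0. This turns
    identities between functions into identities between operators. *)
Lemma cfc_approx_unique phi psi B D : cfc_approx phi A B -> cfc_approx psi A D ->
  (forall t : R, spectrum A t%:C%C -> phi t = psi t) -> B = D.
Proof.
move=> hB hD h; apply/funext => x; apply/eqP; rewrite -subr_eq0 -rnorm_eq0.
rewrite eq_le rnorm_ge0 andbT -(mul0r (rnorm x)).
apply: (cfc_approx_norm (cfc_approx_sub hB hD)) => // t st /=.
by rewrite h// subrr normr0.
Qed.

Lemma cfc_approx_selfadjoint phi B : cfc_approx phi A B -> selfadjoint B.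
Proof.
move=> [bB hB] x y; apply/eqP; rewrite -subr_eq0; apply/eqP/rnorm_small => e e0.
have rp : 0 < 2 * (rnorm x * rnorm y) + 1.
  by rewrite ltr_wpDl// !mulr_ge0 ?rnorm_ge0.
have [q _ h] := hB _ (divr_gt0 e0 rp).
have -> : hdot (B x) y - hdot x (B y) =
    hdot x (poly_op q A y - B y) - hdot (poly_op q A x - B x) y.
  rewrite hdotBr hdotBl poly_op_selfadjoint//; ring.
apply: le_trans (rnormB _ _) _.
apply: le_trans (lerD (CauchySchwarz _ _) (CauchySchwarz _ _)) _.
set d := e / _ in h *.
have h1 : rnorm x * rnorm (poly_op q A y - B y) <= d * (rnorm x * rnorm y).
  by rewrite mulrCA ler_wpM2l ?rnorm_ge0.
have h2 : rnorm (poly_op q A x - B x) * rnorm y <= d * (rnorm x * rnorm y).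
  by rewrite mulrA ler_wpM2r ?rnorm_ge0.
have h3 : d * (2 * (rnorm x * rnorm y) + 1) = e by rewrite divfK// gt_eqF.
have dp : 0 < d by rewrite divr_gt0.
lra.
Qed.

(** Positivity through norms: [0 <= phi <= c] on the spectrum gives [|c - phi| <= c], hence
    [Re <(c - B) x, x> <= c |x|^2], and the terms [c |x|^2] cancel. *)
Lemma cfc_approx_ge0 phi B (c : R) : cfc_approx phi A B ->
  (forall t : R, spectrum A t%:C%C -> 0 <= phi t <= c) ->
  forall x, 0 <= rdot (B x) x.
Proof.
move=> hB hc x.
(* A negative [c] leaves no real point in the spectrum, and the norm bound with constant 0 then
   gives [B = 0]. *)
have [c0|c0] := leP 0 c; last first.
  have B0 := @cfc_approx_norm _ _ 0 hB (lexx 0).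
  rewrite (_ : B x = 0) ?/rdot ?hdot0l//; apply/eqP.
  rewrite -rnorm_eq0 eq_le rnorm_ge0 andbT -(mul0r (rnorm x)) B0// => t /hc.
  by move=> /andP[h1 h2]; have := le_trans h1 h2; rewrite leNgt c0.
have := cfc_approx_norm (cfc_approx_sub (cfc_approx_poly c%:P) hB) c0.
move=> /(_ _ x) h; have {h} h : rnorm (c%:C%C *: x - B x) <= c * rnorm x.
  rewrite -(poly_opC c A); apply: h => t /hc/andP[h1 h2] /=.
  by rewrite hornerC ger0_norm ?subr_ge0// lerBlDr lerDl.
have := rdot_le (c%:C%C *: x - B x) x.
rewrite rdotBl rdotZl rdotxx => h'.
have : rnorm (c%:C%C *: x - B x) * rnorm x <= c * rnorm x * rnorm x.
  by rewrite ler_wpM2r ?rnorm_ge0.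
lra.
Qed.

Lemma cfc_approx_mul phi psi B D (c : R) :
  cfc_approx phi A B -> cfc_approx psi A D -> 0 <= c ->
  (forall t : R, spectrum A t%:C%C -> `|phi t| <= c) ->
  (forall t : R, spectrum A t%:C%C -> `|psi t| <= c) ->
  cfc_approx (phi \* psi) A (B \o D).
Proof.
move=> hB hD c0 hphi hpsi; split; first exact: bounded_comp hB.1 hD.1.
(* With [d <= 1] the product error [(c + d) d + d c] is at most [d (2 c + 1)], hence at most [e]. *)
move=> e e0; set d := Num.min 1 (e / (2 * c + 1)).
have cp : 0 < 2 * c + 1 by rewrite ltr_wpDl// mulr_ge0.
have dp : 0 < d by rewrite lt_min ltr01 divr_gt0.
have d1 : d <= 1 by rewrite ge_min lexx.
have de : d * (2 * c + 1) <= e.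
  by rewrite -ler_pdivlMr// ge_min lexx orbT.
have [q1 h1 k1] := hB.2 _ dp; have [q2 h2 k2] := hD.2 _ dp.
have q1b t : spectrum A t%:C%C -> `|q1.[t]| <= c + d.
  move=> st; have := lerD (hphi t st) (h1 t st); apply: le_trans.
  by rewrite -{1}(subrK (phi t) q1.[t]) addrC ler_normD.
exists (q1 * q2) => [t st|x].
  rewrite hornerM /=.
  have -> : q1.[t] * q2.[t] - phi t * psi t =
    q1.[t] * (q2.[t] - psi t) + (q1.[t] - phi t) * psi t by ring.
  apply: le_trans (ler_normD _ _) _; rewrite !normrM.
  apply: (@le_trans _ _ ((c + d) * d + d * c)); last nra.
  by rewrite lerD// ler_pM// ?q1b ?h1 ?h2 ?hpsi.
rewrite poly_opM//=.
have -> : poly_op q1 A (poly_op q2 A x) - B (D x) =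
    poly_op q1 A (poly_op q2 A x - D x) + (poly_op q1 A (D x) - B (D x)).
  by rewrite (linB (bounded_lin (bounded_poly _ bA))) addrA subrK.
apply: le_trans (rnormD _ _) _.
have n1 : rnorm (poly_op q1 A (poly_op q2 A x - D x)) <= (c + d) * (d * rnorm x).
  apply: le_trans (@norm_poly_op _ _ A q1 (c + d) bA sA _ q1b _) _.
    by rewrite addr_ge0// ltW.
  by rewrite ler_wpM2l// addr_ge0// ltW.
have n2 : rnorm (poly_op q1 A (D x) - B (D x)) <= d * (c * rnorm x).
  apply: le_trans (k1 _) _; rewrite ler_wpM2l ?(ltW dp)//.
  exact: cfc_approx_norm hD c0 hpsi x.
apply: le_trans (lerD n1 n2) _.
rewrite !mulrA -mulrDl ler_wpM2r ?rnorm_ge0//; nra.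
Qed.

Lemma cfc_approx_eigen phi B x (l : R) : cfc_approx phi A B ->
  A x = l%:C%C *: x -> B x = (phi l)%:C%C *: x.
Proof.
move=> [bB hB] Ax.
have [->|x0] := eqVneq x 0; first by rewrite scaler0 (lin0 (bounded_lin bB)).
have sl := eigenvalue_spectrum bA x0 Ax.
apply/eqP; rewrite -subr_eq0; apply/eqP/rnorm_small => e e0.
have rp : 0 < 2 * rnorm x + 1 by rewrite ltr_wpDl// mulr_ge0// rnorm_ge0.
have [q h1 h2] := hB _ (divr_gt0 e0 rp).
have -> : B x - (phi l)%:C%C *: x =
    (q.[l] - phi l)%:C%C *: x - (poly_op q A x - B x).
  rewrite (poly_op_eigen _ bA Ax) rmorphB scalerBl opprB.
  by rewrite [RHS]addrC addrA subrK.
apply: le_trans (rnormB _ _) _; rewrite rnormRZ.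
have := lerD (ler_wpM2r (rnorm_ge0 x) (h1 l sl)) (h2 x).
move=> /le_trans; apply; set d := e / _.
have dE : d * (2 * rnorm x + 1) = e by rewrite divfK// gt_eqF.
have dp : 0 < d by rewrite divr_gt0.
by move: dE; clearbody d; lra.
Qed.

End Properties.

End FunctionalCalculus.
(** * Square roots and polar decomposition *)

Section PositiveCalculus.
Context {R : realType} {H : hilbertType R}.
Local Notation C := R[i]%C.
Implicit Types (S T A B D : H -> H) (x y : H) (phi psi : R -> R).

Section Cfc.
Variable A : H -> H.
Hypothesis pA : positive_op A.
Let bA := pA.1.
Let sA := positive_selfadjoint pA.

Lemma cfc_bounded phi : cont_nonneg phi -> bounded_op (cfc phi A).
Proof. by move=> /(cfcP pA)[]. Qed.

Lemma cfc_selfadjoint phi : cont_nonneg phi -> selfadjoint (cfc phi A).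
Proof. by move=> /(cfcP pA); exact: cfc_approx_selfadjoint. Qed.

Lemma spectrum_bounded : exists2 M : R, 0 < M &
  forall t : R, spectrum A t%:C%C -> 0 <= t <= M.
Proof.
have [M M0 hM] := bounded_bound bA.
by exists M => // t; exact: spectrum_positive.
Qed.

(** Serves twice: with [p = 0] for positivity, and with a tangent line of a power in [jensen]. *)
Lemma cfc_ge_poly phi (p : {poly R}) x : cont_nonneg phi ->
  (forall t, 0 <= t -> p.[t] <= phi t) ->
  rdot (poly_op p A x) x <= rdot (cfc phi A x) x.
Proof.
move=> cphi hp; have [M M0 hM] := spectrum_bounded.
have [c c0 hc] := cont_bounded M cphi.
have [b b0 hb] : exists2 b : R, 0 <= b & forall t, 0 <= t <= M -> `|p.[t]| <= b.
  apply: cont_bounded => s e s0 e0.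
  have /cvgrPdist_lt/(_ _ e0) := @continuous_horner R p s.
  move=> /nbhs_ballP[d /= d0 hd]; exists d => // u u0 us.
  by rewrite distrC; apply: hd; rewrite /ball /= distrC.
rewrite -subr_ge0 -rdotBl.
apply: (@cfc_approx_ge0 _ _ A bA sA (phi \- horner p)
  (cfc phi A \- poly_op p A) (c + b) _ _ x) => [|t /hM tM /=].
  exact: cfc_approx_sub (cfcP pA cphi) (cfc_approx_poly bA p).
have /andP[t0 _] := tM; rewrite subr_ge0 hp//=.
by apply: le_trans (ler_norm _) _; apply: le_trans (ler_normB _ _) _; rewrite lerD ?hc ?hb.
Qed.

Lemma cfc_positive phi : cont_nonneg phi -> (forall t, 0 <= t -> 0 <= phi t) ->
  positive_op (cfc phi A).
Proof.
move=> cphi hphi; apply: positiveP; [exact: cfc_bounded|exact: cfc_selfadjoint|].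
move=> x; have := @cfc_ge_poly phi 0 x cphi; rewrite poly_opC scale0r.
by rewrite {1}/rdot hdot0l; apply => t t0; rewrite horner0 hphi.
Qed.

Lemma cfc_mul_id phi psi : cont_nonneg phi -> cont_nonneg psi ->
  (forall t, 0 <= t -> phi t * psi t = t) -> cfc phi A \o cfc psi A = A.
Proof.
move=> cphi cpsi h; have [M M0 hM] := spectrum_bounded.
have [c c0 hc] := cont_bounded M cphi.
have [d d0 hd] := cont_bounded M cpsi.
have hmul : cfc_approx (phi \* psi) A (cfc phi A \o cfc psi A).
  apply: (cfc_approx_mul bA sA (c := c + d) (cfcP pA cphi) (cfcP pA cpsi)).
  - exact: addr_ge0.
  - by move=> t /hM/hc/le_trans; apply; rewrite lerDl.
  - by move=> t /hM/hd/le_trans; apply; rewrite lerDr.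
rewrite (cfc_approx_unique bA sA hmul (cfc_approx_poly bA 'X)).
  by apply/funext => x; rewrite poly_opX.
by move=> t /hM/andP[t0 _] /=; rewrite hornerX h.
Qed.

Lemma cfc_eigen phi x (l : R) : cont_nonneg phi ->
  A x = l%:C%C *: x -> cfc phi A x = (phi l)%:C%C *: x.
Proof. by move=> cphi; apply: cfc_approx_eigen (cfcP pA cphi). Qed.

End Cfc.

Lemma cont_sqrt : cont_nonneg (@Num.sqrt R).
Proof.
move=> s e s0 e0; have /cvgrPdist_lt/(_ _ e0) := @sqrt_continuous R s.
move=> /nbhs_ballP[d /= d0 hd]; exists d => // u u0 us.
by rewrite distrC; apply: hd; rewrite /ball /= distrC.
Qed.

Lemma sqrt_opP A : positive_op A ->
  positive_op (sqrt_op A) /\ sqrt_op A \o sqrt_op A = A.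
Proof.
move=> pA; rewrite /sqrt_op; set P := (X in xget _ X).
suff : P (xget (fun=> 0) P) by [].
apply: xgetPex; exists (cfc Num.sqrt A); split.
  by apply: cfc_positive => //; exact: cont_sqrt.
apply: cfc_mul_id => //; [exact: cont_sqrt|exact: cont_sqrt|].
by move=> t t0; rewrite -expr2 sqr_sqrtr.
Qed.

Lemma positive_adjoint_mul T : bounded_op T -> positive_op (adjoint T \o T).
Proof.
move=> bT; split; first exact: bounded_comp (bounded_adjoint bT) bT.
by move=> x /=; rewrite adjointEl// hdotxx ler0c sqr_ge0.
Qed.

Lemma abs_positive T : bounded_op T -> positive_op (abs_op T).
Proof. by move=> /positive_adjoint_mul/sqrt_opP[]. Qed.

Lemma abs_sqr T x : bounded_op T -> abs_op T (abs_op T x) = adjoint T (T x).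
Proof.
by move=> /positive_adjoint_mul/sqrt_opP[_]; rewrite -/(abs_op T) => /(congr1 (@^~ x)).
Qed.

Lemma abs_norm T x : bounded_op T -> rnorm (abs_op T x) = rnorm (T x).
Proof.
move=> bT; apply/eqP; rewrite -(@eqrXn2 _ 2) ?rnorm_ge0//.
rewrite -!rdotxx /rdot (positive_selfadjoint (abs_positive bT)) abs_sqr//.
by rewrite -adjointE.
Qed.

Section Polar.
Variable T : H -> H.
Hypothesis bT : bounded_op T.
Let P := abs_op T.
Let lT := bounded_lin bT.
Let lP : linear P := bounded_lin (abs_positive bT).1.
Let sP : selfadjoint P := positive_selfadjoint (abs_positive bT).

Definition abs_range_closure : set H :=
  [set x | forall e : R, 0 < e -> exists y, rnorm (x - P y) < e].

Lemma subspace_abs_range : subspace abs_range_closure.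
Proof.
split=> [e e0|a x y hx hy e e0].
  by exists 0; rewrite (lin0 lP) subrr rnorm0.
have ap : 0 < rnorm a + 1 by rewrite ltr_wpDl ?rnorm_ge0.
have [u hu] := hx _ (divr_gt0 e0 ap); have [v hv] := hy _ (divr_gt0 e0 ap).
exists (a *: u + v); rewrite lP opprD addrACA -scalerBr.
apply: le_lt_trans (rnormD _ _) _; rewrite rnormZ.
apply: le_lt_trans (lerD (ler_wpM2l (rnorm_ge0 _) (ltW hu)) (lexx _)) _.
have aE : e = rnorm a * (e / (rnorm a + 1)) + e / (rnorm a + 1).
  by field; rewrite gt_eqF.
by rewrite {2}aE ltrD2l.
Qed.

Lemma closed_abs_range : eclosed abs_range_closure.
Proof.
move=> x hx e e0; have e20 : 0 < e / 2 by rewrite divr_gt0.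
have [y hy xy] := hx _ e20; have [z hz] := hy _ e20.
exists z; apply: le_lt_trans (rnorm_dist_trans y _ _) _.
by rewrite [e]splitr ltrD.
Qed.

(* The closure of the graph of [P y |-> T y], which is isometric because
   [|P y| = |T y|]. *)
Let G x z := forall e : R, 0 < e ->
  exists y, rnorm (x - P y) < e /\ rnorm (z - T y) < e.

Let G_ex x : abs_range_closure x -> exists z, G x z.
Proof.
move=> hx.
have /choice[u hu] : forall n : nat, exists y, rnorm (x - P y) < n.+1%:R^-1.
  by move=> n; apply: hx; rewrite invr_gt0 ltr0n.
have small (e : R) : 0 < e -> exists N : nat, forall n, (N <= n)%N ->
    rnorm (x - P (u n)) < e.
  move=> e0; have [N _ hN] := @cvgr0_norm_lt _ _ _ _ _ _ (@cvg_harmonic R) _ e0.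
  exists N => n Nn; apply: lt_trans (hu n) _.
  by have := hN n Nn; rewrite /harmonic /= ger0_norm.
have [e e0|z hz] := @seq_complete _ _ (T \o u).
  have [N hN] := small (e / 2) (divr_gt0 e0 (ltr0n _ 2)); exists N => m n Nm Nn.
  rewrite /= -(linB lT) -abs_norm// -/P (linB lP).
  apply: le_lt_trans (rnorm_dist_trans x _ _) _.
  by rewrite [e]splitr rnorm_distC ltrD// hN.
exists z => e e0; have [N1 h1] := small e e0; have [N2 h2] := hz e e0.
exists (u (maxn N1 N2)); split; first by rewrite h1// leq_maxl.
by rewrite rnorm_distC h2// leq_maxr.
Qed.

Let G_lin a x z x' z' : G x z -> G x' z' -> G (a *: x + x') (a *: z + z').
Proof.
move=> h h' e e0.
have ap : 0 < rnorm a + 1 by rewrite ltr_wpDl ?rnorm_ge0.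
have [u [hu ku]] := h _ (divr_gt0 e0 ap); have [v [hv kv]] := h' _ (divr_gt0 e0 ap).
have aE : e = rnorm a * (e / (rnorm a + 1)) + e / (rnorm a + 1).
  by field; rewrite gt_eqF.
exists (a *: u + v); rewrite lP lT !opprD.
rewrite (addrACA (a *: x)) (addrACA (a *: z)) -!scalerBr.
split; apply: le_lt_trans (rnormD _ _) _; rewrite rnormZ [ltRHS]aE.
  by rewrite ler_ltD// ler_wpM2l ?rnorm_ge0// ltW.
by rewrite ler_ltD// ler_wpM2l ?rnorm_ge0// ltW.
Qed.

Let G_norm x z : G x z -> rnorm z = rnorm x.
Proof.
move=> h; apply/eqP; rewrite eq_le; apply/andP; split; apply: le_eps => e e0.
  have [y [h1 h2]] := h _ (divr_gt0 e0 (ltr0n _ 2)).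
  have h3 := rnorm_le_dist z (T y); have h4 := rnorm_le_dist (P y) x.
  by rewrite rnorm_distC abs_norm// in h4; lra.
have [y [h1 h2]] := h _ (divr_gt0 e0 (ltr0n _ 2)).
have h3 := rnorm_le_dist x (P y); have h4 := rnorm_le_dist (T y) z.
by rewrite rnorm_distC in h4; rewrite abs_norm// in h3; lra.
Qed.

(** [U] projects onto the closure of the range of [P] and then applies the isometry with graph [G].
    Its kernel is the orthogonal complement of that range, which is the kernel of [P] and hence of
    [T]. *)
Lemma polar_exists : exists U, [/\ partial_isometry U, T = U \o P &
                                   ker_op U = ker_op T].
Proof.
(* The graph of [U]. It is single valued because, by linearity, two values at [x] differ by a value
   at 0, which [K_norm] makes 0. *)
pose K x z := exists m, [/\ abs_range_closure m,
  forall y, abs_range_closure y -> hdot (x - m) y = 0 & G m z].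
have K_lin a x z x' z' : K x z -> K x' z' -> K (a *: x + x') (a *: z + z').
  move=> [m [h1 h2 h3]] [m' [h1' h2' h3']]; exists (a *: m + m'); split.
  - by apply: subspace_abs_range.2.
  - move=> y hy; rewrite opprD addrACA -scalerBr hdotDl hdotZl h2// h2'//.
    by rewrite mulr0 addr0.
  - exact: G_lin.
have K_norm x z : K x z -> rnorm z <= rnorm x.
  move=> [m [h1 h2 /G_norm ->]]; rewrite -(@ler_pXn2r _ 2) ?nnegrE ?rnorm_ge0//.
  rewrite -[x in leRHS](subrK m) rnormD_sqr /rdot h2//= mulr0 addr0.
  by rewrite lerDr sqr_ge0.
have K_uniq x z z' : K x z -> K x z' -> z = z'.
  move=> h h'; have := K_lin (-1) _ _ _ _ h h'.
  rewrite !scaleN1r addNr => /K_norm; rewrite rnorm0 => h0.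
  by apply/eqP; rewrite eq_sym -subr_eq0 addrC -rnorm_eq0 eq_le h0 rnorm_ge0.
have /choice[U hU] x : exists z, K x z.
  have [m hm h2] := projection subspace_abs_range closed_abs_range x.
  by have [z hz] := G_ex hm; exists z, m.
have lU : linear U by move=> a x y; apply: K_uniq (hU _) _; exact: K_lin.
have bU : bounded_op U.
  apply: (@bound_bounded _ _ 1) => //; split=> // x; rewrite mul1r.
  exact: K_norm (hU x).
have PM x : abs_range_closure (P x).
  by move=> e e0; exists x; rewrite subrr rnorm0.
have ker x : U x = 0 <-> forall y, abs_range_closure y -> hdot x y = 0.
  split=> [Ux0|hx].
    have [m [h1 h2 /G_norm]] := hU x; rewrite Ux0 rnorm0 => /esym/eqP.
    by rewrite rnorm_eq0 => /eqP m0 y /h2; rewrite m0 subr0.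
  apply: K_uniq (hU x) _; exists 0; split.
  - exact: subspace_abs_range.1.
  - by move=> y; rewrite subr0; exact: hx.
  - by move=> e e0; exists 0; rewrite (lin0 lP) (lin0 lT) subr0 rnorm0.
exists U; split.
- split=> // x hx; rewrite !rnormE; congr _%:C%C.
  have [m [h1 h2 /G_norm ->]] := hU x.
  (* [x - m] is orthogonal to the range, so it lies in the kernel of [U], to which [x] is
     orthogonal; it is orthogonal to [m] as well. Thus [x = m]. *)
  have : hdot (x - m) (x - m) = 0.
    rewrite hdotBr (h2 m)// subr0 hdotC hx ?rmorph0//.
    by rewrite /ker_op /=; apply/ker.
  rewrite hdotxx => /eqP; rewrite (inj_eq (@complexI R) _ 0) sqrf_eq0 rnorm_eq0.
  by rewrite subr_eq0 => /eqP <-.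
- apply/funext => x /=; apply/esym; apply: K_uniq (hU _) _.
  exists (P x); split; first exact: PM.
    by move=> y _; rewrite subrr hdot0l.
  by move=> e e0; exists x; rewrite !subrr rnorm0.
- apply/seteqP; split=> x; rewrite /ker_op /=; [move=> /ker h|move=> Tx0].
    apply/eqP; rewrite -rnorm_eq0 -abs_norm// -sqrf_eq0 -rdotxx /rdot sP h//.
  apply: (ker x).2 => y hy; apply/rnorm_small => e e0.
  have xp : 0 < rnorm x + 1 by rewrite ltr_wpDl ?rnorm_ge0.
  have [z hz] := hy _ (divr_gt0 e0 xp).
  have -> : hdot x y = hdot x (y - P z).
    rewrite hdotBr -sP (_ : P x = 0) ?hdot0l ?subr0//.
    by apply/eqP; rewrite -rnorm_eq0 abs_norm// Tx0 rnorm0.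
  apply: le_trans (CauchySchwarz _ _) _.
  apply: (@le_trans _ _ ((rnorm x + 1) * (e / (rnorm x + 1)))).
    by rewrite ler_pM ?rnorm_ge0 ?lerDl// ltW.
  by rewrite mulrC divfK// gt_eqF.
Qed.

Lemma polar_opP : [/\ partial_isometry (polar_op T), T = polar_op T \o abs_op T &
                      ker_op (polar_op T) = ker_op T].
Proof.
rewrite {1 2 3}/polar_op; set Q := (X in xget _ X).
suff : Q (xget (fun=> 0) Q) by [].
by apply: xgetPex; exact: polar_exists.
Qed.

End Polar.

Lemma partial_isometry_contraction U : partial_isometry U ->
  forall x, rnorm (U x) <= rnorm x.
Proof.
move=> [bU hU] x; have lU := bounded_lin bU.
have [||m hm h] := @projection _ _ (ker_op U) _ _ x.
- split; first exact: lin0.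
  by move=> a u v; rewrite /ker_op /= lU => -> ->; rewrite scaler0 addr0.
- move=> u hu; apply: rnorm_small => e e0.
  have [M Mp [_ hM]] := bounded_bound bU.
  have [y Uy uy] := hu _ (divr_gt0 e0 Mp).
  have -> : U u = U (u - y) by rewrite linB// Uy subr0.
  by apply: le_trans (hM _) _; rewrite mulrC -ler_pdivlMr// ltW.
have -> : U x = U (x - m) by rewrite linB// hm subr0.
rewrite /rnorm hU// -(@ler_pXn2r _ 2) ?nnegrE ?rnorm_ge0// -!/(rnorm _).
rewrite -[x in leRHS](subrK m) [leRHS]rnormD_sqr /rdot h//= mulr0 addr0.
by rewrite lerDl sqr_ge0.
Qed.

Lemma polar_contraction T : bounded_op T -> bound_op 1 (polar_op T).
Proof.
move=> bT; split=> // x; rewrite mul1r; apply: partial_isometry_contraction.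
by have [] := polar_opP bT.
Qed.

Lemma polar_bounded T : bounded_op T -> bounded_op (polar_op T).
Proof. by move=> bT; have [[]] := polar_opP bT. Qed.

Lemma polar_abs T x : bounded_op T -> polar_op T (abs_op T x) = T x.
Proof. by move=> bT; have [_ E _] := polar_opP bT; rewrite [in RHS]E. Qed.

End PositiveCalculus.
(** * Orthonormal bases and traces *)

Section PowR.
Context {R : realType}.
Implicit Types (r s t : R).

Lemma cont_powR r : 0 < r -> cont_nonneg (fun x : R => x `^ r).
Proof.
move=> r0 s e s0 e0.
(* At 0 the power need not be differentiable; there [u^r < e] is solved for [u] directly. *)
have [s00|sn0] := eqVneq s 0.
  exists (e `^ r^-1); first by rewrite powR_gt0.
  move=> u u0; rewrite s00 subr0 powR0 ?gt_eqF// subr0 !ger0_norm ?powR_ge0// => ue.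
  have -> : e = (e `^ r^-1) `^ r by rewrite -powRrM mulVf ?gt_eqF// powRr1// ltW.
  by apply: gt0_ltr_powR; rewrite ?nnegrE ?powR_ge0.
have sp : 0 < s by rewrite lt_neqAle eq_sym sn0.
have dp : derivable (fun x : R => x `^ r) s 1.
  by apply: derivable_powR; rewrite in_itv /= sp.
have : {for s, continuous (fun x : R => x `^ r)}.
  by apply: differentiable_continuous; apply/derivable1_diffP.
move=> /cvgrPdist_lt/(_ _ e0)/nbhs_ballP[d /= d0 hd]; exists d => // u u0 us.
by rewrite distrC; apply: hd; rewrite /ball /= distrC.
Qed.

(** Young's inequality for [t] and [s^(r - 1)] with exponents [r] and [r / (r - 1)], multiplied by
    [r]. The left side is the tangent line of the convex function [t^r] at [s]. *)
Lemma powR_tangent r s t : 1 <= r -> 0 <= s -> 0 <= t ->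
  r * s `^ (r - 1) * t - (r - 1) * s `^ r <= t `^ r.
Proof.
move=> r1 s0 t0; have [->|rn1] := eqVneq r 1.
  by rewrite subrr powRr0 !powRr1// mul0r subr0 !mul1r.
have rgt1 : 1 < r by rewrite lt_neqAle eq_sym rn1.
have rp : 0 < r by exact: lt_trans ltr01 rgt1.
have r1p : 0 < r - 1 by rewrite subr_gt0.
have := @conjugate_powR _ t (s `^ (r - 1)) r (r / (r - 1)) t0 (powR_ge0 _ _) rp
  (divr_gt0 rp r1p) _.
have -> : r^-1 + (r / (r - 1))^-1 = 1 by field; rewrite !gt_eqF.
move=> /(_ erefl); rewrite -powRrM (_ : (r - 1) * (r / (r - 1)) = r); last first.
  by field; rewrite gt_eqF.
move=> h; have := ler_wpM2l (ltW rp) h.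
rewrite mulrDr (_ : r * (t `^ r / r) = t `^ r); last by field; rewrite gt_eqF.
rewrite (_ : r * (s `^ r / (r / (r - 1))) = (r - 1) * s `^ r); last first.
  by field; rewrite !gt_eqF.
lra.
Qed.

Lemma powR_succ r s : 1 <= r -> 0 <= s -> s `^ (r - 1) * s = s `^ r.
Proof.
move=> r1 s0; have [->|sn0] := eqVneq s 0.
  by rewrite mulr0 powR0// gt_eqF// (lt_le_trans ltr01).
by rewrite -{2}(powRr1 s0) -powRD ?subrK// sn0 implybT.
Qed.

End PowR.

Lemma ler_sum_subset {R : realType} {T : eqType} (s t : seq T) (a : T -> R) :
  uniq s -> uniq t -> {subset s <= t} -> (forall i, 0 <= a i) ->
  \sum_(i <- s) a i <= \sum_(i <- t) a i.
Proof.
move=> us ut st a0; rewrite [leRHS](bigID (mem s)) /= -[X in _ <= X + _]big_filter.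
rewrite [X in _ <= X + _](_ : _ = \sum_(i <- s) a i); first by rewrite lerDl sumr_ge0.
apply: perm_big; apply: uniq_perm => //; first exact: filter_uniq.
by move=> i; rewrite mem_filter /=; have [/st ->|] := boolP (i \in s).
Qed.

(** Reduces every trace estimate to finite duplicate-free lists of basis vectors, where sums can be
    exchanged freely. *)
Lemma esum_leP {R : realType} {T : choiceType} (S : set T) (a : T -> R) (c : R) :
  (\esum_(i in S) (a i)%:E <= c%:E)%E <->
  forall s : seq T, uniq s -> (forall i, i \in s -> S i) -> \sum_(i <- s) a i <= c.
Proof.
split=> [h s us sS|h].
  rewrite -lee_fin; apply: le_trans h; apply: ereal_sup_ubound.
  exists [set` s]; first by split; [exact: finite_seq|].
  rewrite fsbig_finite/=; last exact: finite_seq.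
  rewrite sumEFin; congr _%:E; apply: perm_big; apply: uniq_perm => // i.
  by rewrite in_fset_set ?inE; [|exact: finite_seq]; apply/idP/idP; rewrite ?in_setE.
apply: ge_ereal_sup => _ [X [finX XS] <-].
rewrite fsbig_finite// sumEFin lee_fin; apply: h => // i.
by rewrite in_fset_set// inE => /XS.
Qed.

Section Orthonormal.
Context {R : realType} {H : hilbertType R}.
Local Notation C := R[i]%C.
Implicit Types (x y e f : H) (E F : set H) (S A K W : H -> H) (s t : seq H).

Definition orthonormal_set E :=
  (forall e, E e -> `|e| = 1) /\
  (forall e e', E e -> E e' -> e <> e' -> hdot e e' = 0).

Definition list_in E s := uniq s /\ forall e, e \in s -> E e.

Lemma orthonormal_basis_set E : orthonormal_basis E -> orthonormal_set E.
Proof. by case. Qed.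

Lemma orthonormal_unit E e : orthonormal_set E -> E e -> rnorm e = 1.
Proof. by move=> [h _] /h; rewrite /rnorm => ->. Qed.

Definition partial_proj s x : H := \sum_(e <- s) hdot x e *: e.

Lemma partial_proj_ortho E s x e : orthonormal_set E -> list_in E s -> E e ->
  e \notin s -> hdot (partial_proj s x) e = 0.
Proof.
move=> [_ oE] [us sE] Ee es; rewrite hdot_suml big1_seq// => f /andP[_ fs].
rewrite hdotZl (oE f e (sE f fs) Ee) ?mulr0// => fe.
by move: es; rewrite -fe fs.
Qed.

Lemma bessel_eq E s x : orthonormal_set E -> list_in E s ->
  rnorm (x - partial_proj s x) ^+ 2 =
  rnorm x ^+ 2 - \sum_(e <- s) rnorm (hdot x e) ^+ 2.
Proof.
move=> oE; elim: s => [|e s IH] [us sE].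
  by rewrite /partial_proj !big_nil !subr0.
have {}IH : rnorm (x - partial_proj s x) ^+ 2 =
    rnorm x ^+ 2 - \sum_(e <- s) rnorm (hdot x e) ^+ 2.
  by apply: IH; split=> [|f fs]; [case/andP: us|apply: sE; rewrite inE fs orbT].
have Ee : E e by apply: sE; rewrite mem_head.
have sE' : list_in E s.
  by split=> [|f fs]; [case/andP: us|apply: sE; rewrite inE fs orbT].
have h0 : hdot (x - partial_proj s x) e = hdot x e.
  rewrite hdotBl (partial_proj_ortho _ oE sE' Ee) ?subr0//.
  by case/andP: us.
rewrite /partial_proj !big_cons -/(partial_proj s x).
rewrite [hdot x e *: e + _]addrC opprD addrA rnormB_sqr IH rnormZ.
rewrite (orthonormal_unit oE Ee) mulr1 [rdot _ _]/rdot hdotZr h0.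
have -> : complex.Re ((hdot x e)^*%C * hdot x e) = rnorm (hdot x e) ^+ 2.
  by rewrite mulrC -sqr_normc rnormE -rmorphXn.
ring.
Qed.

Lemma bessel E s x : orthonormal_set E -> list_in E s ->
  \sum_(e <- s) rnorm (hdot x e) ^+ 2 <= rnorm x ^+ 2.
Proof.
by move=> oE sE; rewrite -subr_ge0 -(bessel_eq x oE sE) sqr_ge0.
Qed.

Lemma partial_projB s x y : partial_proj s (x - y) = partial_proj s x - partial_proj s y.
Proof.
rewrite /partial_proj -sumrB; apply: eq_bigr => e _.
by rewrite hdotBl scalerBl.
Qed.

Lemma partial_proj_id E s e : orthonormal_set E -> list_in E s -> e \in s ->
  partial_proj s e = e.
Proof.
move=> oE [us sE] es; rewrite /partial_proj (bigD1_seq e)//= big1_seq ?addr0.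
  by rewrite hdotxx (orthonormal_unit oE (sE _ es)) expr1n scale1r.
move=> f /andP[fe fs]; case: oE => _ oE.
rewrite (oE e f (sE e es) (sE f fs)) ?scale0r// => ef.
by rewrite ef eqxx in fe.
Qed.

(** Finite combinations of [E] are dense, since the orthogonal complement of their closure [M] is 0.
    If a combination [v] is within [sqrt d] of [x], the projection onto the vectors occurring in [v]
    is no farther from [x]. *)
Lemma parseval E x (d : R) : orthonormal_basis E -> 0 < d ->
  exists2 s, list_in E s & rnorm x ^+ 2 <= \sum_(e <- s) rnorm (hdot x e) ^+ 2 + d.
Proof.
move=> bE d0; have oE := orthonormal_basis_set bE.
pose M : set H := [set x | forall d : R, 0 < d ->
  exists2 s : seq (C * H), forall ce, ce \in s -> E ce.2 &
    rnorm (x - \sum_(ce <- s) ce.1 *: ce.2) < d].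
have sM : subspace M.
  split=> [c c0|a u v hu hv c c0].
    by exists [::]; rewrite // big_nil subr0 rnorm0.
  have ap : 0 < rnorm a + 1 by rewrite ltr_wpDl ?rnorm_ge0.
  have [s sE hs] := hu _ (divr_gt0 c0 ap); have [t tE ht] := hv _ (divr_gt0 c0 ap).
  exists ([seq (a * ce.1, ce.2) | ce <- s] ++ t).
    by move=> e; rewrite mem_cat => /orP[/mapP[e' /sE ? ->//]|/tE].
  rewrite big_cat big_map /=.
  have -> : \sum_(ce <- s) (a * ce.1) *: ce.2 = a *: \sum_(ce <- s) ce.1 *: ce.2.
    by rewrite scaler_sumr; apply: eq_bigr => e _; rewrite scalerA.
  rewrite opprD addrACA -scalerBr; apply: le_lt_trans (rnormD _ _) _.
  have cE : c = rnorm a * (c / (rnorm a + 1)) + c / (rnorm a + 1).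
    by field; rewrite gt_eqF.
  by rewrite rnormZ [ltRHS]cE ler_ltD// ler_wpM2l ?rnorm_ge0// ltW.
have cM : eclosed M.
  move=> u hu c c0; have c20 : 0 < c / 2 by rewrite divr_gt0.
  have [v hv uv] := hu _ c20; have [s sE hs] := hv _ c20.
  exists s => //; apply: le_lt_trans (rnorm_dist_trans v _ _) _.
  by rewrite [c]splitr ltrD.
have EM e : E e -> M e.
  move=> Ee c c0; exists [:: (1, e)] => [f|]; first by rewrite inE => /eqP ->.
  by rewrite big_cons big_nil addr0 scale1r subrr rnorm0.
have : M x.
  apply: orthogonal_complement_trivial => // z hz.
  by case: bE => _ _; apply => e /EM; exact: hz.
have sd : 0 < Num.sqrt d by rewrite sqrtr_gt0.
move=> /(_ _ sd)[s sE hs].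
set v := \sum_(ce <- s) _ in hs; pose t := undup [seq ce.2 | ce <- s].
have tE : list_in E t.
  split; first exact: undup_uniq.
  by move=> e; rewrite mem_undup => /mapP[f /sE ? ->].
exists t => //.
have pv : partial_proj t v = v.
  rewrite /v /partial_proj.
  under eq_bigr => e _ do rewrite hdot_suml scaler_suml.
  rewrite exchange_big /=; apply: eq_big_seq => e es.
  under eq_bigr => f _ do rewrite hdotZl -scalerA.
  rewrite -scaler_sumr; congr (_ *: _); apply: (partial_proj_id oE tE).
  by rewrite mem_undup; apply/mapP; exists e.
rewrite addrC -lerBlDr -(bessel_eq x oE tE).
(* The projection fixes [v], so its error at [x] equals its error at [x - v], which Bessel's
   identity bounds by [|x - v|]. *)
have -> : x - partial_proj t x = (x - v) - partial_proj t (x - v).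
  by rewrite partial_projB pv opprB addrA subrK.
rewrite (bessel_eq (x - v) oE tE); apply: (@le_trans _ _ (rnorm (x - v) ^+ 2)).
  by rewrite gerBl sumr_ge0// => e _; rewrite sqr_ge0.
have dE : d = Num.sqrt d ^+ 2 by rewrite sqr_sqrtr// ltW.
by rewrite [leRHS]dE ler_pXn2r ?nnegrE ?rnorm_ge0 ?(ltW sd)// ltW.
Qed.

Lemma parseval_seq E (xs : seq H) (d : R) : orthonormal_basis E -> 0 < d ->
  exists2 s, list_in E s & forall x, x \in xs ->
    rnorm x ^+ 2 <= \sum_(e <- s) rnorm (hdot x e) ^+ 2 + d.
Proof.
move=> bE d0; elim: xs => [|x xs [s [us sE] hs]]; first by exists [::].
have [t [ut tE] ht] := parseval x bE d0.
exists (undup (s ++ t)).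
  split; first exact: undup_uniq.
  by move=> e; rewrite mem_undup mem_cat => /orP[/sE|/tE].
move=> y; rewrite inE => /orP[/eqP ->|/hs h].
  apply: le_trans ht _; rewrite lerD2r; apply: ler_sum_subset => //.
  - exact: undup_uniq.
  - by move=> e et; rewrite mem_undup mem_cat et orbT.
  - by move=> e; rewrite sqr_ge0.
apply: le_trans h _; rewrite lerD2r; apply: ler_sum_subset => //.
- exact: undup_uniq.
- by move=> e es; rewrite mem_undup mem_cat es.
- by move=> e; rewrite sqr_ge0.
Qed.

(* Both sides are double sums of the |<S e, f>|^2: Parseval in [f], then
   Bessel in [e]. *)
Lemma hilbert_schmidt_le E F S S' (c : R) : orthonormal_set E ->
  orthonormal_basis F -> (forall x y, hdot (S x) y = hdot x (S' y)) ->
  (forall s, list_in F s -> \sum_(f <- s) rnorm (S' f) ^+ 2 <= c) ->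
  forall s, list_in E s -> \sum_(e <- s) rnorm (S e) ^+ 2 <= c.
Proof.
move=> oE bF hS hc s sE; apply: le_eps => d d0.
(* Each vector of [s] is allowed an error of [d / (size s + 1)], in total at most [d]; the successor
   keeps the denominator positive for an empty list. *)
have nd : 0 < d / (size s).+1%:R by rewrite divr_gt0// ltr0n.
have [t tF ht] := parseval_seq [seq S e | e <- s] bF nd.
apply: (@le_trans _ _ (\sum_(e <- s)
    (\sum_(f <- t) rnorm (hdot (S e) f) ^+ 2 + d / (size s).+1%:R))).
  rewrite big_seq [leRHS]big_seq; apply: ler_sum => e es.
  by apply: ht; apply/mapP; exists e.
rewrite big_split /= big_const_seq count_predT iter_addr_0 exchange_big /=.
apply: lerD.
  apply: le_trans (hc t tF); apply: ler_sum => f _.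
  apply: le_trans (bessel (S' f) oE sE).
  apply: ler_sum => e _; rewrite hS hdotC rnorm_conj.
  exact: lexx.
rewrite -[_ *+ size s]mulr_natr mulrAC ler_pdivrMr ?ltr0n// ler_wpM2l ?(ltW d0)//.
by rewrite ler_nat.
Qed.

Lemma jensen A (r : R) x y : positive_op A -> 1 <= r -> rnorm x <= 1 ->
  rnorm y <= 1 -> 2 * rnorm (hdot (A x) y) `^ r <=
    rdot (cfc (fun u : R => u `^ r) A x) x + rdot (cfc (fun u : R => u `^ r) A y) y.
Proof.
move=> pA r1 x1 y1; set D := cfc _ A; have [pS SE] := sqrt_opP pA.
have sS := positive_selfadjoint pS; set S := sqrt_op A in pS SE sS.
have AE z : A z = S (S z) by rewrite -{1}SE.
set s := rnorm (hdot (A x) y).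
have s0 : 0 <= s by exact: rnorm_ge0.
have hs : 2 * s <= rdot (A x) x + rdot (A y) y.
  have : s <= rnorm (S x) * rnorm (S y) by rewrite /s AE sS CauchySchwarz.
  have rA z : rdot (A z) z = rnorm (S z) ^+ 2 by rewrite AE -rdotxx /rdot sS.
  rewrite !rA.
  have := sqr_ge0 (rnorm (S x) - rnorm (S y)); nra.
have rp : 0 < r by exact: lt_le_trans ltr01 r1.
have tang z : rnorm z <= 1 ->
    r * s `^ (r - 1) * rdot (A z) z - (r - 1) * s `^ r <= rdot (D z) z.
  move=> z1; pose p : {poly R} := (r * s `^ (r - 1)) *: 'X - ((r - 1) * s `^ r)%:P.
  have h : rdot (poly_op p A z) z <= rdot (D z) z.
    apply: cfc_ge_poly => //; first exact: cont_powR.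
    by move=> u u0; rewrite !hornerE; exact: powR_tangent.
  apply: le_trans h.
  rewrite poly_opB poly_opZ poly_opX poly_opC rdotBl !rdotZl rdotxx lerB//.
  rewrite ler_piMr ?mulr_ge0 ?powR_ge0 ?subr_ge0//.
  by rewrite exprn_ile1// rnorm_ge0.
have h1 := tang x x1; have h2 := tang y y1.
have h3 : r * s `^ (r - 1) * (2 * s) <=
    r * s `^ (r - 1) * (rdot (A x) x + rdot (A y) y).
  by rewrite ler_wpM2l ?mulr_ge0 ?powR_ge0// ltW.
have h4 := powR_succ r1 s0.
have h5 : r * s `^ (r - 1) * (2 * s) = 2 * r * s `^ r by rewrite -h4; ring.
lra.
Qed.

Definition contraction W := bounded_op W /\ forall x, rnorm (W x) <= rnorm x.

Lemma contraction_comp W W' : contraction W -> contraction W' -> contraction (W \o W').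
Proof.
move=> [bW hW] [bW' hW']; split; first exact: bounded_comp.
by move=> x; apply: le_trans (hW _) (hW' x).
Qed.

Lemma contraction_id : contraction id.
Proof. by split=> //; exact: bounded_id. Qed.

Lemma contraction_adjoint W : contraction W -> contraction (adjoint W).
Proof.
move=> [bW hW]; split; first exact: bounded_adjoint.
have : bound_op 1 W by split=> // x; rewrite mul1r.
by move=> /(bound_adjoint bW)[_ h] x; have := h x; rewrite mul1r.
Qed.

Lemma contraction_polar T : bounded_op T -> contraction (polar_op T).
Proof.
move=> bT; split; first exact: polar_bounded.
by have [_ h] := polar_contraction bT; move=> x; rewrite -[leRHS]mul1r.
Qed.

(** Compares the traces of [W' D W] and [D]: with [S] the square root of [D], the sum of [|S W f|^2]
    is exchanged for that of [|W' S e|^2], and [W'] is a contraction. For [W = id] it is a change of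
    basis. *)
Lemma trace_hilbert_schmidt E F D W (c : R) : positive_op D -> contraction W ->
  orthonormal_basis E -> orthonormal_set F ->
  (forall s, list_in E s -> \sum_(e <- s) rdot (D e) e <= c) ->
  forall s, list_in F s -> \sum_(f <- s) rdot (D (W f)) (W f) <= c.
Proof.
move=> pD cW bE oF hc s sF; have [pS SE] := sqrt_opP pD.
have sS := positive_selfadjoint pS; set S := sqrt_op D in pS SE sS.
have DE z : rdot (D z) z = rnorm (S z) ^+ 2.
  by rewrite -rdotxx -{1}SE /rdot /= sS.
under eq_bigr => f _ do rewrite DE.
have cW' := contraction_adjoint cW.
apply: (@hilbert_schmidt_le F E (S \o W) (adjoint W \o S)) sF => //.
  by move=> x y /=; rewrite sS (adjointE cW.1).
move=> t tE; apply: le_trans (hc t tE); apply: ler_sum => e _.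
by rewrite DE ler_pXn2r ?nnegrE ?rnorm_ge0//; exact: cW'.2.
Qed.

Lemma abs_pow_positive K (r : R) : bounded_op K -> 0 < r ->
  positive_op (cfc (fun u : R => u `^ r) (abs_op K)).
Proof.
move=> bK r0; apply: cfc_positive; first exact: abs_positive.
  exact: cont_powR.
by move=> t _; exact: powR_ge0.
Qed.

Lemma trace_op_leP A (c : R) : (trace_op A <= c%:E)%E <->
  forall s, list_in (xget set0 (@orthonormal_basis R H)) s ->
    \sum_(e <- s) rdot (A e) e <= c.
Proof.
split=> [/esum_leP h s [us sE]|h]; first exact: h.
by apply/esum_leP => s us sE; apply: h.
Qed.

(** Writing [K = V |K|] turns each entry into [<|K| W1 f, V' W2 f>], where contractions keep both
    vectors in the unit ball. Each of the two diagonal sums produced by [jensen] is at most [c], and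
    its factor 2 compensates for their number. *)
Lemma diag_sum_le F K W1 W2 (r c : R) : bounded_op K -> contraction W1 ->
  contraction W2 -> (exists E, @orthonormal_basis R H E) -> orthonormal_set F ->
  1 <= r -> (trace_abs_pow r K <= c%:E)%E ->
  forall s, list_in F s -> \sum_(f <- s) rnorm (hdot (K (W1 f)) (W2 f)) `^ r <= c.
Proof.
move=> bK c1 c2 exE oF r1 /trace_op_leP hc s sF.
have rp : 0 < r by exact: lt_le_trans ltr01 r1.
(* Without a basis [xget] would return the empty set and [hc] would say nothing; [exE] excludes
   this. *)
set E := xget _ _ in hc; have bE : orthonormal_basis E by exact: xgetPex.
set Q := abs_op K in hc; have pQ : positive_op Q by exact: abs_positive.
set D := cfc _ Q in hc; have pD : positive_op D by exact: abs_pow_positive.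
set V := polar_op K; have cV : contraction V by exact: contraction_polar.
have cV2 : contraction (adjoint V \o W2).
  by apply: contraction_comp => //; exact: contraction_adjoint.
have hf f : f \in s -> 2 * rnorm (hdot (K (W1 f)) (W2 f)) `^ r <=
    rdot (D (W1 f)) (W1 f) + rdot (D ((adjoint V \o W2) f)) ((adjoint V \o W2) f).
  move=> fs; have f1 : rnorm f = 1 by apply: orthonormal_unit oF (sF.2 _ fs).
  rewrite -(polar_abs _ bK) (adjointE cV.1); apply: jensen => //.
    by rewrite -f1; exact: c1.2.
  by rewrite -f1; exact: cV2.2.
have h1 := trace_hilbert_schmidt pD c1 bE oF hc sF.
have h2 := trace_hilbert_schmidt pD cV2 bE oF hc sF.
have : 2 * \sum_(f <- s) rnorm (hdot (K (W1 f)) (W2 f)) `^ r <= c + c.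
  rewrite mulr_sumr; apply: le_trans (lerD h1 h2); rewrite -big_split /=.
  by rewrite big_seq [leRHS]big_seq; apply: ler_sum => f /hf.
lra.
Qed.

End Orthonormal.
(** * Spectral theorem for compact positive operators *)

Section Compact.
Context {R : realType} {H : hilbertType R}.
Local Notation C := R[i]%C.
Implicit Types (x y e w : H) (E M : set H) (S T X Y : H -> H).

Lemma ultraI (F : set_system H) (A B : set H) :
  UltraFilter F -> F A -> F B -> F (A `&` B).
Proof. by move=> UF; exact: filterI. Qed.

(** Compactness through ultrafilters: the same ultrafilter serves several operators at once, where
    sequences would call for successive subsequences. *)
Definition ultra_compact T := forall F : set_system H, UltraFilter F ->
  F [set x | rnorm x <= 1] ->
  exists w, forall d : R, 0 < d -> F [set x | rnorm (T x - w) < d].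

(** A cluster point of an ultrafilter is a limit. The map [phi] lets the ultrafilter live upstream
    of [T], as the composite of [T] with its adjoint requires. *)
Lemma compact_op_ultra T (phi : H -> H) (F : set_system H) : compact_op T ->
  UltraFilter F -> F [set x | rnorm (phi x) <= 1] ->
  exists w, forall d : R, 0 < d -> F [set x | rnorm (T (phi x) - w) < d].
Proof.
move=> [_ cT] UF Fphi.
have PF : ProperFilter ((T \o phi) @ F) by exact: fmap_proper_filter.
have [|w [_ cw]] := cT _ PF _.
  suff : F [set x | closure [set T x | x in [set x | `|x| <= 1]] (T (phi x))] by [].
  move: Fphi; apply: filterS => x /= hx; apply: subset_closure.
  by exists (phi x); rewrite /= ?rnorm_le1.
exists w => d d0.
have [//|nF] := in_ultra_setVsetC [set x | rnorm (T (phi x) - w) < d] UF.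
have dC : 0 < (d%:C)%C :> C by rewrite ltcR.
have [||z [/= hz bz]] := cw [set y | ~ rnorm (y - w) < d] (ball w d%:C%C) _ _.
- exact: nF.
- exact: nbhsx_ballx.
by case: hz; move: bz; rewrite -ball_normE /ball_ /= rnormE ltcR rnorm_distC.
Qed.

Lemma ultra_compact_op T : compact_op T -> ultra_compact T.
Proof. by move=> cT F UF hF; exact: (@compact_op_ultra T id F cT UF hF). Qed.

(** Schauder's theorem: [|T' y|^2 = <T T' y, y>], so along an ultrafilter in the unit ball the
    convergence of [T T'] makes the image under [T'] Cauchy. *)
Lemma ultra_compact_adjoint T : compact_op T -> ultra_compact (adjoint T).
Proof.
move=> cT F UF FB; have [bT _] := cT.
have bT' := bounded_adjoint bT; have lT' := bounded_lin bT'.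
have lT := bounded_lin bT.
have [M Mp [M0 hM]] := bounded_bound bT'.
have [|w hw] := @compact_op_ultra T (fun x => M^-1%:C%C *: adjoint T x) F cT UF _.
  apply: filterS FB => x /= x1; rewrite rnormRZ ger0_norm ?invr_ge0//.
  rewrite ler_pdivrMl// mulr1; apply: le_trans (hM x) _.
  by rewrite ler_piMr.
have Fproper : ProperFilter (adjoint T @ F) by exact: fmap_proper_filter.
have [d d0|l hl] := @filter_complete _ _ (adjoint T @ F) Fproper.
  (* Two vectors of the filter set satisfy [|T T' (x0 - x)| <= 2 M c] and [|x0 - x| <= 2]; the
     product of the bounds is [4 M c = d^2 / 2]. *)
  set c := d ^+ 2 / (8 * M).
  have cp : 0 < c by rewrite divr_gt0 ?exprn_gt0 ?mulr_gt0.
  have F2 := ultraI UF FB (hw c cp).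
  have [x0 [/= x01 h0]] := filter_ex F2.
  exists (adjoint T x0); apply: filterS F2 => x [/= x1 hx].
  rewrite -(linB lT') -(@ltr_pXn2r _ 2) ?nnegrE ?rnorm_ge0 ?(ltW d0)//.
  rewrite -rdotxx /rdot -adjointE// -/(rdot _ _).
  apply: le_lt_trans (rdot_le _ _) _.
  have h1 : rnorm (x0 - x) <= 2 by apply: le_trans (rnormB _ _) _; lra.
  have h2 : rnorm (T (adjoint T (x0 - x))) <= M * (c + c).
    have -> : T (adjoint T (x0 - x)) = M%:C%C *:
        (T (M^-1%:C%C *: adjoint T x0) - T (M^-1%:C%C *: adjoint T x)).
      rewrite !(linZ lT) -scalerBr scalerA -rmorphM /= divff ?gt_eqF//.
      by rewrite scale1r (linB lT') (linB lT).
    rewrite rnormRZ (ger0_norm M0) ler_wpM2l//.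
    apply: le_trans (rnorm_dist_trans w _ _) _.
    by rewrite lerD// ?ltW// rnorm_distC.
  have h3 : M * (c + c) * 2 = d ^+ 2 / 2 by rewrite /c; field; rewrite gt_eqF.
  apply: le_lt_trans (ler_pM (rnorm_ge0 _) (rnorm_ge0 _) h2 h1) _.
  by rewrite h3 ltr_pdivrMr// ltr_pMr ?exprn_gt0// ltr1n.
exists l => d d0; have : F [set x | rnorm (l - adjoint T x) < d] by exact: hl.
by apply: filterS => x /=; rewrite rnorm_distC.
Qed.

Lemma ultra_compact_comb (a b : C) S T : ultra_compact S -> ultra_compact T ->
  ultra_compact (fun x => a *: S x + b *: T x).
Proof.
move=> cS cT F UF FB; have [v hv] := cS F UF FB; have [w hw] := cT F UF FB.
exists (a *: v + b *: w) => d d0.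
set k := rnorm a + rnorm b + 1.
have kp : 0 < k by rewrite ltr_wpDl// addr_ge0 ?rnorm_ge0.
have dk : 0 < d / k by rewrite divr_gt0.
apply: filterS (ultraI UF (hv _ dk) (hw _ dk)) => x [/= h1 h2].
rewrite opprD addrACA -!scalerBr; apply: le_lt_trans (rnormD _ _) _.
rewrite !rnormZ.
have h3 := ler_wpM2l (rnorm_ge0 a) (ltW h1).
have h4 := ler_wpM2l (rnorm_ge0 b) (ltW h2).
apply: le_lt_trans (lerD h3 h4) _.
have dE : d = rnorm a * (d / k) + rnorm b * (d / k) + d / k.
  by rewrite /k; field; rewrite gt_eqF.
by rewrite [ltRHS]dE ltrDl.
Qed.

Lemma ultra_compact_comp S T : bounded_op S -> ultra_compact T ->
  ultra_compact (S \o T).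
Proof.
move=> bS cT F UF FB; have [w hw] := cT F UF FB; exists (S w) => d d0.
have [M Mp [M0 hM]] := bounded_bound bS.
apply: filterS (hw _ (divr_gt0 d0 Mp)) => x /= h.
rewrite -(linB (bounded_lin bS)); apply: le_lt_trans (hM _) _.
by rewrite mulrC -ltr_pdivlMr.
Qed.

(** Let [a] be the supremum of [|Y x|] on the unit ball of [M]. Nearly maximizing vectors are
    approximate eigenvectors of [Y^2] for [a^2]; compactness yields a true one, [z], and
    [(Y - a) (Y + a) z = 0] makes [Y z + a z] an eigenvector of [Y]. *)
Lemma compact_eigenvector Y M : positive_op Y -> ultra_compact Y ->
  subspace M -> eclosed M -> (forall x, M x -> M (Y x)) ->
  (exists2 x, M x & x != 0) ->
  exists y, [/\ M y, y != 0 & exists l : R, Y y = l%:C%C *: y].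
Proof.
move=> pY cY sM cM YM [x0 Mx0 x00]; have [bY _] := pY.
have lY := bounded_lin bY; have sY := positive_selfadjoint pY.
have [K Kp [K0 hK]] := bounded_bound bY.
set D := [set rnorm (Y x) | x in [set x | M x /\ rnorm x <= 1]].
have Dsup : has_sup D.
  split; first by exists (rnorm (Y 0)), 0 => //=; rewrite rnorm0; split=> //; case: sM.
  by exists K => _ [x /= [_ x1] <-]; apply: le_trans (hK x) _; rewrite ler_piMr.
set a := sup D.
have a0 : 0 <= a.
  apply: ub_le_sup; [by case: Dsup|exists 0; rewrite /= ?rnorm0 ?lin0// ?rnorm0//].
  by split=> //; case: sM.
have ha x : M x -> rnorm (Y x) <= a * rnorm x.
  move=> Mx; have [->|xn0] := eqVneq x 0; first by rewrite lin0// rnorm0 mulr0.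
  have xp : 0 < rnorm x by rewrite rnorm_gt0.
  have ip : 0 <= (rnorm x)^-1 by rewrite invr_ge0 ltW.
  have : rnorm (Y ((rnorm x)^-1%:C%C *: x)) <= a.
    apply: ub_le_sup; first by case: Dsup.
    exists ((rnorm x)^-1%:C%C *: x) => //=; split; first exact: subspaceZ.
    by rewrite rnormRZ ger0_norm// mulVf// gt_eqF.
  by rewrite linZ// rnormRZ ger0_norm// ler_pdivrMl// mulrC.
have adh (d : R) : 0 < d -> exists x, [/\ M x, rnorm x <= 1 & a - d < rnorm (Y x)].
  by move=> d0; have [_ [x [Mx x1] <-] h] := sup_adherent d0 Dsup; exists x.
clearbody a.
have [a00|an0] := eqVneq a 0.
  exists x0; split=> //; exists 0; rewrite scale0r; apply/eqP.
  by rewrite -rnorm_eq0 eq_le rnorm_ge0 andbT -(mul0r (rnorm x0)) -a00 ha.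
have ap : 0 < a by rewrite lt_neqAle eq_sym an0.
have near_sup x : M x -> rnorm x <= 1 ->
    rnorm (Y (Y x) - (a ^+ 2)%:C%C *: x) ^+ 2 <= a ^+ 2 * (a ^+ 2 - rnorm (Y x) ^+ 2).
  move=> Mx x1; rewrite rnormB_sqr rdotZr rnormRZ exprMn real_normK ?num_real//.
  have -> : rdot (Y (Y x)) x = rnorm (Y x) ^+ 2 by rewrite -rdotxx /rdot sY.
  have h1 : rnorm (Y (Y x)) ^+ 2 <= (a * rnorm (Y x)) ^+ 2.
    by rewrite ler_pXn2r ?nnegrE ?mulr_ge0 ?rnorm_ge0// ha//; exact: YM.
  have h2 : rnorm x ^+ 2 <= 1 by rewrite exprn_ile1 ?rnorm_ge0.
  have h3 : (a ^+ 2) ^+ 2 * rnorm x ^+ 2 <= (a ^+ 2) ^+ 2.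
    by rewrite ler_piMr ?sqr_ge0.
  rewrite exprMn in h1; lra.
have /choice[u hu] : forall n : nat, exists x,
    [/\ M x, rnorm x <= 1 & a - n.+1%:R^-1 < rnorm (Y x)].
  by move=> n; apply: adh; rewrite invr_gt0 ltr0n.
(* An ultrafilter finer than the maximizing sequence plays the role of a convergent subsequence. *)
have [G [UG subG]] := @ultraFilterLemma _ (u @ \oo) _.
have GM : G [set x | M x /\ rnorm x <= 1].
  by apply: subG; exists 0%N => // n _ /=; have [] := hu n.
have Ga (d : R) : 0 < d -> G [set x | a - d < rnorm (Y x)].
  move=> d0; apply: subG.
  have [N _ hN] := @cvgr0_norm_lt _ _ _ _ _ _ (@cvg_harmonic R) _ d0.
  exists N => // n Nn /=; have [_ _] := hu n; apply: le_lt_trans.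
  by rewrite lerB// ltW//; have := hN n Nn; rewrite /harmonic /= ger0_norm.
have [|w hw] := cY G UG _; first by apply: filterS GM => x [].
(* [w] is the limit of [Y x], so [z] is the limit of [Y^2 x] and, by [near_sup], of [a^2 x]. *)
set z := Y w.
have approx (d : R) : 0 < d -> exists x, [/\ M x, rnorm x <= 1, a - d < rnorm (Y x),
    rnorm (Y (Y x) - (a ^+ 2)%:C%C *: x) < d & rnorm ((a ^+ 2)%:C%C *: x - z) < d].
  move=> d0.
  (* The three bounds on [c] control, in turn, the distance to the supremum, the error [2 a^3 c]
     coming from [near_sup], and [|Y (Y x) - z| <= K c]. *)
  set c := Num.min d (Num.min ((d / 2) ^+ 2 / (2 * a ^+ 3 + 1)) (d / (2 * K))).
  have a3 : 0 < 2 * a ^+ 3 + 1 by rewrite ltr_wpDl// mulr_ge0// exprn_ge0.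
  have cp : 0 < c.
    by rewrite !lt_min d0 !divr_gt0 ?exprn_gt0 ?mulr_gt0// divr_gt0.
  have c1 : c <= d by rewrite ge_min lexx.
  have c2 : c * (2 * a ^+ 3 + 1) <= (d / 2) ^+ 2.
    by rewrite -ler_pdivlMr// /c !ge_min lexx !orbT.
  have c3 : K * c <= d / 2.
    have : c <= d / (2 * K) by rewrite /c !ge_min lexx !orbT.
    by rewrite ler_pdivlMr ?mulr_gt0// => h; lra.
  clearbody c; have [x [/= [[Mx x1] hx]] hxw] :=
    filter_ex (ultraI UG (ultraI UG GM (Ga c cp)) (hw c cp)).
  have h1 : rnorm (Y (Y x) - (a ^+ 2)%:C%C *: x) < d / 2.
    rewrite -(@ltr_pXn2r _ 2) ?nnegrE ?rnorm_ge0 ?divr_ge0 ?(ltW d0)//.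
    apply: le_lt_trans (near_sup x Mx x1) _; apply: lt_le_trans c2.
    have yx : rnorm (Y x) <= a by apply: le_trans (ha x Mx) _; rewrite ler_piMr.
    have : a ^+ 2 - rnorm (Y x) ^+ 2 <= 2 * a * c.
      have -> : a ^+ 2 - rnorm (Y x) ^+ 2 = (a + rnorm (Y x)) * (a - rnorm (Y x)) by ring.
      by apply: ler_pM; [rewrite addr_ge0 ?rnorm_ge0|rewrite subr_ge0|lra|lra].
    move=> /(ler_wpM2l (sqr_ge0 a)) /le_lt_trans; apply.
    have -> : a ^+ 2 * (2 * a * c) = c * (2 * a ^+ 3) by ring.
    by rewrite ltr_pM2l// ltrDl.
  exists x; split=> //.
  - by apply: le_lt_trans hx; rewrite lerB.
  - by apply: lt_trans h1 _; rewrite ltr_pdivrMr// ltr_pMr// ltr1n.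
  - apply: le_lt_trans (rnorm_dist_trans (Y (Y x)) _ _) _.
    rewrite [d]splitr rnorm_distC ltr_leD// -(linB lY).
    apply: le_trans (hK _) _; apply: le_trans c3.
    by rewrite ler_wpM2l// ltW.
have Mz : M z.
  apply: cM => d d0; have [x [Mx _ _ _ h]] := approx d d0.
  by exists ((a ^+ 2)%:C%C *: x); [exact: subspaceZ|rewrite rnorm_distC].
have z0 : z != 0.
  apply/negP => /eqP z0.
  (* If [z = 0], some [x] has [a^2 |x| < a^2 / 2] and yet [a |x| >= |Y x| > a / 2]. *)
  set d := Num.min (a / 2) (a ^+ 2 / 2).
  have dp : 0 < d by rewrite lt_min !divr_gt0 ?exprn_gt0.
  have d1 : d <= a / 2 by rewrite ge_min lexx.
  have d2 : d <= a ^+ 2 / 2 by rewrite ge_min lexx orbT.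
  have [x [Mx _ h1 _]] := approx d dp; rewrite z0 subr0 rnormRZ ger0_norm ?sqr_ge0//.
  have := ha x Mx => h2 h3.
  have h4 : a * (a / 2) <= a * (a * rnorm x) by rewrite ler_wpM2l//; lra.
  nra.
have zE : Y (Y z) = (a ^+ 2)%:C%C *: z.
  apply/eqP; rewrite -subr_eq0; apply/eqP/rnorm_small => d d0.
  set k := K * K + a ^+ 2 + a ^+ 2.
  have kp : 0 < k by rewrite !addr_gt0 ?mulr_gt0.
  have [x [Mx x1 h1 h2 h3]] := approx (d / k) (divr_gt0 d0 kp).
  have -> : Y (Y z) - (a ^+ 2)%:C%C *: z =
      (a ^+ 2)%:C%C *: (Y (Y x) - (a ^+ 2)%:C%C *: x)
      - Y (Y ((a ^+ 2)%:C%C *: x - z)) + (a ^+ 2)%:C%C *: ((a ^+ 2)%:C%C *: x - z).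
    have idP (p q r s : H) : s - r = p - q - (p - s) + (q - r).
      by rewrite opprB [p - q + _]addrC (addrA (s - p)) subrK (addrA (s - q)) subrK.
    by rewrite !(linB lY) !(linZ lY) !scalerBr; exact: idP.
  apply: le_trans (rnormD _ _) _; rewrite rnormRZ ger0_norm ?sqr_ge0//.
  apply: le_trans (lerD (rnormB _ _) (lexx _)) _; rewrite rnormRZ ger0_norm ?sqr_ge0//.
  have h4 : rnorm (Y (Y ((a ^+ 2)%:C%C *: x - z))) <= K * (K * (d / k)).
    apply: le_trans (hK _) _; rewrite ler_wpM2l//.
    by apply: le_trans (hK _) _; rewrite ler_wpM2l// ltW.
  have dE : d = k * (d / k) by rewrite mulrC divfK// gt_eqF.
  have h5 := ler_wpM2l (sqr_ge0 a) (ltW h2).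
  have h6 := ler_wpM2l (sqr_ge0 a) (ltW h3).
  rewrite [leRHS]dE; move: h4 h5 h6; set c := d / k; clearbody c.
  by rewrite /k; lra.
(* By positivity of [Y] the inner product of this vector with [z] is at least [a |z|^2], so it is
   non-zero. *)
exists (Y z + a%:C%C *: z); split.
- by apply: subspaceD; [exact: sM|exact: YM|exact: subspaceZ].
- apply/eqP => h; have : 0 < rdot (Y z + a%:C%C *: z) z.
    rewrite rdotDl rdotZl rdotxx ltr_wpDl ?positive_ge0// mulr_gt0// exprn_gt0//.
    by rewrite rnorm_gt0.
  by rewrite h /rdot hdot0l ltxx.
- exists a; rewrite linD// linZ// zE scalerDr scalerA -rmorphM -expr2.
  by rewrite addrC.
Qed.

(** Zorn's lemma on orthonormal sets of eigenvectors. The orthogonal complement of a maximal one is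
    closed and invariant under [Y]; if it were non-zero, [compact_eigenvector] would enlarge the
    set. *)
Lemma compact_spectral Y : positive_op Y -> ultra_compact Y ->
  exists E, orthonormal_basis E /\
    forall e, E e -> exists l : R, Y e = l%:C%C *: e.
Proof.
move=> pY cY; have sY := positive_selfadjoint pY.
pose P : set (set H) := [set E | orthonormal_set E /\
  forall e, E e -> exists l : R, Y e = l%:C%C *: e].
have [F FP totF|E [[oE eE] maxE]] := @Zorn_bigcup H P.
  split; last by move=> e [A FA Ae]; apply: (FP A FA).2.
  split=> [e [A FA Ae]|e e' [A FA Ae] [B FB Be']]; first exact: (FP A FA).1.1.
  have [AB|BA] := totF A B FA FB.
    by apply: (FP B FB).1.2 => //; exact: AB.
  by apply: (FP A FA).1.2 => //; exact: BA.
exists E; split=> //; case: (oE) => oE1 oE2; split=> // x hx.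
apply/eqP/negP => /negP x0.
pose M : set H := [set x | forall e, E e -> hdot x e = 0].
have sM : subspace M.
  split=> [e _|a u v hu hv e Ee]; first by rewrite hdot0l.
  by rewrite hdotDl hdotZl hu// hv// mulr0 addr0.
have cM : eclosed M.
  move=> u hu e Ee; apply: rnorm_small => d d0.
  have [v Mv uv] := hu d d0.
  have -> : hdot u e = hdot (u - v) e by rewrite hdotBl Mv// subr0.
  apply: le_trans (CauchySchwarz _ _) _.
  by rewrite (orthonormal_unit oE Ee) mulr1 ltW.
have YM u : M u -> M (Y u).
  by move=> Mu e Ee; have [l le] := eE e Ee; rewrite sY le hdotZr Mu// mulr0.
have [|y [My y0 [l Yy]]] := compact_eigenvector pY cY sM cM YM _; first by exists x.
have yp : 0 < rnorm y by rewrite rnorm_gt0.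
set u := (rnorm y)^-1%:C%C *: y.
have u1 : rnorm u = 1.
  by rewrite rnormRZ ger0_norm ?invr_ge0 ?rnorm_ge0// mulVf// gt_eqF.
have Mu : M u by exact: (subspaceZ sM _ My).
apply: (maxE (E `|` [set u])).
  split=> [|sub]; first exact: subsetUl.
  have Eu : E u by apply: sub; right.
  have := Mu u Eu; rewrite hdotxx u1 expr1n => /eqP.
  by rewrite oner_eq0.
split; last first.
  move=> e [/eE//|->]; exists l.
  by rewrite /u (linZ (bounded_lin pY.1)) Yy !scalerA mulrC.
split=> [e [/oE1//|->]|e e' [Ee|->] [Ee'|->]//].
- by rewrite rnormE u1.
- exact: oE2.
- by move=> _; rewrite hdotC Mu// rmorph0.
- by move=> _; exact: Mu.
Qed.

End Compact.
(** * The numerical radius *)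

(** Convexity after normalization: [(u + v) / (a + b)] is the average of [u / a] and [v / b] with
    weights [a / (a + b)] and [b / (a + b)]. If [a] or [b] is 0, the corresponding function vanishes
    on [s]. *)
Lemma minkowski_seq {R : realType} {T : eqType} (s : seq T) (u v : T -> R)
    (r a b : R) : 1 <= r -> 0 <= a -> 0 <= b ->
  (forall i, 0 <= u i) -> (forall i, 0 <= v i) ->
  \sum_(i <- s) u i `^ r <= a `^ r -> \sum_(i <- s) v i `^ r <= b `^ r ->
  \sum_(i <- s) (u i + v i) `^ r <= (a + b) `^ r.
Proof.
move=> r1 a0 b0 u0 v0 ua vb.
have rp : 0 < r by exact: lt_le_trans ltr01 r1.
have zero (w : T -> R) i : (forall i, 0 <= w i) ->
    \sum_(i <- s) w i `^ r <= 0 `^ r -> i \in s -> w i = 0.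
  move=> w0; rewrite powR0 ?gt_eqF// => h si.
  have /eqP : \sum_(i <- s) w i `^ r = 0.
    by apply/eqP; rewrite eq_le h sumr_ge0// => j _; exact: powR_ge0.
  rewrite psumr_eq0 => [/allP/(_ i si)/= /eqP/powR_eq0_eq0//|j _].
  exact: powR_ge0.
have [a00|an0] := eqVneq a 0.
  rewrite a00 in ua *; rewrite add0r; apply: le_trans vb.
  rewrite big_seq [leRHS]big_seq; apply: ler_sum => i.
  by move=> /(zero u i u0 ua) ->; rewrite add0r.
have [b00|bn0] := eqVneq b 0.
  rewrite b00 in vb *; rewrite addr0; apply: le_trans ua.
  rewrite big_seq [leRHS]big_seq; apply: ler_sum => i.
  by move=> /(zero v i v0 vb) ->; rewrite addr0.
have ap : 0 < a by rewrite lt_neqAle eq_sym an0.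
have bp : 0 < b by rewrite lt_neqAle eq_sym bn0.
have abp : 0 < a + b by rewrite addr_gt0.
pose l := a / (a + b); pose l' := b / (a + b).
have l0 : 0 <= l by rewrite divr_ge0// ltW.
have l'0 : 0 <= l' by rewrite divr_ge0// ltW.
have ll' : l + l' = 1 by rewrite /l /l'; field; rewrite gt_eqF.
have pw (x c : R) : 0 <= x -> 0 < c -> (x / c) `^ r = x `^ r / c `^ r.
  by move=> x0 c0; rewrite powRM ?invr_ge0 ?(ltW c0)// -powR_inv1 ?(ltW c0)//
     -powRrM mulN1r powRN.
have term i : (u i + v i) `^ r <= (a + b) `^ r *
    (l / a `^ r * u i `^ r + l' / b `^ r * v i `^ r).
  set x := u i / a; set y := v i / b; set m := (u i + v i) / (a + b).
  have x0 : 0 <= x by rewrite divr_ge0.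
  have y0 : 0 <= y by rewrite divr_ge0.
  have m0 : 0 <= m by rewrite divr_ge0 ?addr_ge0// ltW.
  have mE : m = l * x + l' * y.
    by rewrite /m /l /l' /x /y; field; rewrite !gt_eqF.
  have t1 := ler_wpM2l l0 (powR_tangent r1 m0 x0).
  have t2 := ler_wpM2l l'0 (powR_tangent r1 m0 y0).
  have mm := powR_succ r1 m0.
  (* Convexity from the tangent at the average [m]: the weighted sum of its values at [x] and [y] is
     [m^r]. *)
  have h : m `^ r <= l * x `^ r + l' * y `^ r.
    apply: le_trans (lerD t1 t2); rewrite le_eqVlt; apply/orP; left; apply/eqP.
    have -> : l * (r * m `^ (r - 1) * x - (r - 1) * m `^ r) +
       l' * (r * m `^ (r - 1) * y - (r - 1) * m `^ r) =
       r * m `^ (r - 1) * (l * x + l' * y) - (l + l') * (r - 1) * m `^ r by ring.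
    by rewrite -mE ll' -mulrA mm; ring.
  have pab : 0 <= (a + b) `^ r by exact: powR_ge0.
  have := ler_wpM2l pab h; rewrite -powRM ?(ltW abp)//.
  rewrite (_ : (a + b) * m = u i + v i); last by rewrite /m mulrC divfK// gt_eqF.
  by move=> /le_trans; apply; rewrite /x /y !pw// !mulrA !(mulrAC _ (_ `^ r) (_^-1)).
apply: le_trans (ler_sum _ (fun i _ => term i)) _.
rewrite -mulr_sumr big_split /= -!mulr_sumr ler_piMr ?powR_ge0//.
rewrite -ll'; have := powR_gt0 r ap; have := powR_gt0 r bp => bpp app.
by apply: lerD; rewrite -mulrA ler_piMr// ler_pdivrMl// mulr1.
Qed.

Section NumericalRadius.
Context {R : realType} {H : hilbertType R}.
Local Notation C := R[i]%C.
Variables (T : H -> H).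
Hypothesis bT : bounded_op T.
Let bT' := bounded_adjoint bT.
Let P := abs_op T.
Let U := polar_op T.
Let pP : positive_op P := abs_positive bT.
Let sP : selfadjoint P := positive_selfadjoint pP.
Let bU : bounded_op U := polar_bounded bT.
Let cU : contraction U := contraction_polar bT.

Lemma polar_adjoint x : adjoint T x = P (adjoint U x).
Proof.
rewrite (@adjoint_unique _ _ T (P \o adjoint U))// => y z /=.
by rewrite -(polar_abs _ bT) -/U -/P (adjointE bU) sP.
Qed.

Section Re.
Variable c : C.
Hypothesis c1 : rnorm c = 1.
Let X := re_op (c \*: T).

Let conj_c1 : rnorm c^*%C = 1.
Proof. by rewrite rnorm_conj. Qed.

Let bS : bounded_op (c \*: T) := bounded_scale c bT.

Lemma adjoint_scale : adjoint (c \*: T) = c^*%C \*: adjoint T.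
Proof.
apply: adjoint_unique => // x y /=.
by rewrite hdotZl hdotZr conjcK adjointE.
Qed.

Lemma re_opE x : X x = (2^-1 : C) *: (c *: T x + c^*%C *: adjoint T x).
Proof. by rewrite /X /re_op adjoint_scale. Qed.

Lemma re_op_bounded : bounded_op X.
Proof.
exact: bounded_scale (bounded_add bS (bounded_adjoint bS)).
Qed.

Lemma re_op_selfadjoint : selfadjoint X.
Proof.
move=> x y; rewrite /X /re_op /= hdotZl hdotZr hdotDl hdotDr.
rewrite -(adjointE bS) (adjointEl bS) addrC.
by congr (_ * _); rewrite fmorphV rmorph_nat.
Qed.

(** The phases drop out of the two squared norms and multiply to [c^2] in the cross term, since the
    inner product conjugates the second one once more. *)
Lemma rnorm_re_op_sqr x : rnorm (X x) ^+ 2 = 4^-1 *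
  (rdot (adjoint T (T x) + T (adjoint T x)) x
   + 2 * complex.Re (c * c * hdot (T (T x)) x)).
Proof.
have e1 : rdot (c *: T x) (c^*%C *: adjoint T x) = complex.Re (c * c * hdot (T (T x)) x).
  by rewrite /rdot hdotZl hdotZr conjcK mulrA -(adjointE bT).
have e2 : rdot (adjoint T (T x) + T (adjoint T x)) x =
    rnorm (T x) ^+ 2 + rnorm (adjoint T x) ^+ 2.
  by rewrite rdotDl -!rdotxx /rdot adjointEl// (adjointE bT (adjoint T x)).
rewrite re_opE; have -> : (2^-1 : C) = (2^-1)%:C%C by rewrite fmorphV rmorph_nat.
rewrite rnormRZ exprMn real_normK ?num_real// rnormD_sqr !rnormZ c1 conj_c1 !mul1r.
by rewrite e1 e2 exprVn -natrX.
Qed.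

(** The cross term is at most twice [|<T^2 x, x>|]. One copy is the modulus of [<P U P x, U' x>],
    the other that of [<P U' P U' x, x>], which is the conjugate number [<T'^2 x, x>]. *)
Lemma rnorm_re_op_le x : rnorm (X x) ^+ 2 <= 4^-1 *
  (rnorm (hdot (P (U (P x))) (adjoint U x))
   + rnorm (hdot (P (adjoint U (P (adjoint U x)))) x)
   + rnorm (hdot (adjoint T (T x) + T (adjoint T x)) x)).
Proof.
rewrite rnorm_re_op_sqr ler_wpM2l ?invr_ge0//.
have -> : hdot (P (U (P x))) (adjoint U x) = hdot (T (T x)) x.
  by rewrite -(adjointE bU) -!(polar_abs _ bT).
rewrite -!polar_adjoint [X in _ <= _ + rnorm X + _](_ : _ = (hdot (T (T x)) x)^*%C).
  rewrite rnorm_conj addrC.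
  have h : complex.Re (c * c * hdot (T (T x)) x) <= rnorm (hdot (T (T x)) x).
    by apply: le_trans (Re_ge_rnorm _) _; rewrite !rnormM c1 !mul1r.
  by rewrite mulr_natl mulr2n lerD ?lerD// Re_ge_rnorm.
by rewrite !adjointEl// -hdotC.
Qed.

End Re.

Lemma rnorm_expi (theta : R) : rnorm (expi theta) = 1.
Proof.
apply/eqP; rewrite -(@eqrXn2 _ 2) ?rnorm_ge0//.
by rewrite rnorm_sqr /= cos2Dsin2 expr1n.
Qed.

End NumericalRadius.

(** * Schatten norms and traces of selfadjoint operators *)

Section SchattenBounds.
Context {R : realType} {H : hilbertType R}.
Local Notation C := R[i]%C.
Implicit Types (T X K : H -> H) (c : C).

Lemma opnorm_real T : bounded_op T -> exists2 a : R, 0 <= a & opnorm T = a%:E.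
Proof.
move=> bT; have [M Mp [M0 hM]] := bounded_bound bT.
have h0 := opnorm_ge0 (bounded_lin bT).
have /(opnorm_le (bounded_lin bT) M0) hT := hM.
case: (opnorm T) h0 hT => [a||]//; rewrite lee_fin => a0 _.
by exists a.
Qed.

Lemma trace_abs_pow_ge0 (r : R) K : bounded_op K -> 0 < r ->
  (0 <= trace_abs_pow r K)%E.
Proof.
move=> bK r0; apply: esum_ge0 => e _; rewrite lee_fin.
exact: positive_ge0 (abs_pow_positive bK r0).
Qed.

Lemma re_op_compact T c : compact_op T -> ultra_compact (re_op (c \*: T)).
Proof.
move=> cT; have [bT _] := cT.
rewrite (_ : re_op _ = fun x => (2^-1 * c) *: T x + (2^-1 * c^*%C) *: adjoint T x).
  by apply: ultra_compact_comb; [exact: ultra_compact_op|exact: ultra_compact_adjoint].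
by apply/funext => x; rewrite re_opE// scalerDr !scalerA.
Qed.

(** With [m = |X e|], the operator [(|X| + m) (|X| - m) = X^2 - m^2] annihilates [e], and for
    [m > 0] positivity makes [|X| + m] injective. *)
Lemma abs_selfadjoint_eigen X e (l : R) : bounded_op X -> selfadjoint X ->
  rnorm e = 1 -> X (X e) = l%:C%C *: e -> abs_op X e = (rnorm (X e))%:C%C *: e.
Proof.
move=> bX sX e1 Xe; set m := rnorm (X e).
have pA := abs_positive bX; have lA := bounded_lin pA.1.
have lE : l = m ^+ 2.
  have : rdot (X (X e)) e = m ^+ 2 by rewrite -rdotxx /rdot sX.
  by rewrite Xe rdotZl rdotxx e1 expr1n mulr1.
have [m0|mn0] := eqVneq m 0.
  by apply/eqP; rewrite m0 scale0r -rnorm_eq0 abs_norm// -/m m0.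
have mp : 0 < m by rewrite lt_neqAle eq_sym mn0 rnorm_ge0.
set v := abs_op X e - m%:C%C *: e.
have vE : abs_op X v = (- m)%:C%C *: v.
  rewrite /v (linB lA) (linZ lA) abs_sqr// adjoint_self// Xe lE expr2 rmorphM.
  by rewrite scalerBr scalerA rmorphN !mulNr !scaleNr opprK addrC.
have := positive_ge0 v pA; rewrite vE rdotZl rdotxx mulNr oppr_ge0 pmulr_rle0// => v0.
have /eqP : rnorm v ^+ 2 = 0 by apply/eqP; rewrite eq_le v0 sqr_ge0.
by rewrite sqrf_eq0 rnorm_eq0 subr_eq0 => /eqP.
Qed.

(** The basis chosen in the trace is traded for the eigenbasis by [trace_hilbert_schmidt] with
    [W = id]; there [|X|^q e = |X e|^q e]. *)
Lemma trace_selfadjoint_le X (q d : R) E : bounded_op X -> selfadjoint X ->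
  0 < q -> orthonormal_basis E ->
  (forall e, E e -> exists l : R, X (X e) = l%:C%C *: e) ->
  (forall s, list_in E s -> \sum_(e <- s) rnorm (X e) `^ q <= d) ->
  (trace_abs_pow q X <= d%:E)%E.
Proof.
move=> bX sX q0 bE hE hd; apply/trace_op_leP => s sE0.
set E0 := xget _ _ in sE0.
have bE0 : orthonormal_basis E0 by apply: xgetPex; exists E.
set Q := cfc _ _; have pQ : positive_op Q by exact: abs_pow_positive.
apply: (trace_hilbert_schmidt pQ (contraction_id (H := H)) bE
  (orthonormal_basis_set bE0) _ sE0) => t tE.
apply: le_trans (hd t tE); rewrite big_seq [leRHS]big_seq; apply: ler_sum => e et.
have Ee := tE.2 _ et; have [l Xl] := hE e Ee.
have e1 := orthonormal_unit (orthonormal_basis_set bE) Ee.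
have := abs_selfadjoint_eigen bX sX e1 Xl.
move=> /(cfc_eigen (abs_positive bX) (cont_powR q0)); rewrite -/Q => ->.
by rewrite rdotZl rdotxx e1 expr1n mulr1.
Qed.

Lemma sup_sqr_le (p : \bar R) T (b : R) : 0 <= b ->
  (forall theta, 0 <= schatten_norm p (re_op (expi theta \*: T)) <= (Num.sqrt b)%:E)%E ->
  (schatten_num_radius p T ^+ 2 <= b%:E)%E.
Proof.
move=> b0 h.
(* Squaring is monotone only on non-negative values; the angle 0 shows that the supremum is one. *)
have w0 : (0 <= schatten_num_radius p T)%E.
  have /andP[h0 _] := h 0; apply: le_trans h0 _.
  by apply: ereal_sup_ubound; exists 0.
have wb : (schatten_num_radius p T <= (Num.sqrt b)%:E)%E.
  by apply: ge_ereal_sup => _ [t _ <-]; have /andP[] := h t.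
case: (schatten_num_radius p T) w0 wb => [w||]//; rewrite !lee_fin => w0 wb.
by apply: le_trans (ler_pM w0 w0 wb wb) _; rewrite -expr2 sqr_sqrtr.
Qed.

End SchattenBounds.

(** * The bound in terms of [P U P] and [P U' P] *)

Section MainBound.
Context {R : realType} {H : hilbertType R}.
Variable T : H -> H.
Hypothesis bT : bounded_op T.
Let bT' := bounded_adjoint bT.
Let P := abs_op T.
Let U := polar_op T.
Let pP : positive_op P := abs_positive bT.
Let bU : bounded_op U := polar_bounded bT.
Let cU : contraction U := contraction_polar bT.
Let cU' : contraction (adjoint U) := contraction_adjoint cU.

Let A := P \o U \o P.
Let B := P \o adjoint U \o P.
Let D := (adjoint T \o T) \+ (T \o adjoint T).

Let bA : bounded_op A.
Proof. by apply: bounded_comp pP.1; apply: bounded_comp pP.1 bU. Qed.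

Let bB : bounded_op B.
Proof. by apply: bounded_comp pP.1; apply: bounded_comp pP.1 cU'.1. Qed.

Let bD : bounded_op D.
Proof. exact: bounded_add (bounded_comp bT' bT) (bounded_comp bT bT'). Qed.

Let num_radius_bound theta x :
  rnorm (re_op (expi theta \*: T) x) ^+ 2 <= 4^-1 *
  (rnorm (hdot (A x) (adjoint U x)) + rnorm (hdot (B (adjoint U x)) x)
   + rnorm (hdot (D x) x)).
Proof. exact: rnorm_re_op_le (rnorm_expi theta) x. Qed.

Let bX theta : bounded_op (re_op (expi theta \*: T)).
Proof. exact: re_op_bounded. Qed.

Lemma opnorm_num_radius_le :
  (schatten_num_radius +oo T ^+ 2 <=
   (4^-1)%:E * (opnorm A + opnorm B + opnorm D))%E.
Proof.
have [a a0 aE] := opnorm_real bA; have [b b0 bE] := opnorm_real bB.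
have [d d0 dE] := opnorm_real bD.
have hn (K : H -> H) k x y z : bounded_op K -> 0 <= k -> opnorm K = k%:E ->
    rnorm x <= rnorm z -> rnorm y <= rnorm z ->
    rnorm (hdot (K x) y) <= k * rnorm z ^+ 2.
  move=> bK k0 kE xz yz; apply: le_trans (CauchySchwarz _ _) _.
  have /(opnorm_le (bounded_lin bK) k0) hK : (opnorm K <= k%:E)%E by rewrite kE.
  rewrite expr2 mulrA ler_pM ?rnorm_ge0//; apply: le_trans (hK _) _.
  by rewrite ler_wpM2l.
rewrite aE bE dE -!EFinD -EFinM; apply: sup_sqr_le => [|theta].
  by rewrite mulr_ge0 ?invr_ge0// !addr_ge0.
have lX := bounded_lin (bX theta); set m := 4^-1 * _.
have m0 : 0 <= m by rewrite mulr_ge0 ?invr_ge0// !addr_ge0.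
apply/andP; split; first exact: opnorm_ge0.
apply/(opnorm_le lX (sqrtr_ge0 _)) => x.
rewrite -(@ler_pXn2r _ 2) ?nnegrE ?mulr_ge0 ?rnorm_ge0 ?sqrtr_ge0//.
rewrite exprMn sqr_sqrtr//; apply: le_trans (num_radius_bound theta x) _.
rewrite -mulrA ler_wpM2l ?invr_ge0// !mulrDl.
have hx := cU'.2 x.
by apply: lerD; first apply: lerD; apply: hn.
Qed.

Lemma schatten_num_radius_le (q : R) : 2 <= q -> compact_op T ->
  (schatten_num_radius q%:E T ^+ 2 <=
   (4^-1)%:E * (schatten_norm (q / 2)%:E A + schatten_norm (q / 2)%:E B
                + schatten_norm (q / 2)%:E D))%E.
Proof.
move=> q2 cT; set r := q / 2.
have r1 : 1 <= r by rewrite ler_pdivlMr// mul1r.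
have r0 : 0 < r by exact: lt_le_trans ltr01 r1.
have q0 : 0 < q by apply: lt_le_trans q2.
have snorm (K : H -> H) : bounded_op K -> schatten_norm r%:E K = +oo%E \/
    exists2 k : R, 0 <= k & (trace_abs_pow r K <= (k `^ r)%:E)%E /\
      schatten_norm r%:E K = k%:E.
  move=> bK; have := trace_abs_pow_ge0 bK r0; rewrite /=.
  case: (trace_abs_pow r K) => [t||]//.
    rewrite lee_fin => t0; right; exists (t `^ r^-1); first exact: powR_ge0.
    by rewrite poweR_EFin -powRrM mulVf ?gt_eqF// powRr1.
  by move=> _; left; rewrite poweRyr// invr_neq0// gt_eqF.
have snorm_ge0 (K : H -> H) : bounded_op K -> (0 <= schatten_norm r%:E K)%E.
  by move=> bK; exact: poweR_ge0.
have nA := snorm_ge0 _ bA; have nB := snorm_ge0 _ bB; have nD := snorm_ge0 _ bD.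
have top : ((4^-1)%:E * +oo = +oo :> \bar R)%E by rewrite gt0_muley// lte_fin invr_gt0.
(* An infinite norm on the right makes the inequality trivial, so only finite values [a], [b], [d]
   remain. *)
have sum_top (x y z : \bar R) : (0 <= x)%E -> (0 <= y)%E -> (0 <= z)%E ->
    x = +oo%E \/ y = +oo%E \/ z = +oo%E -> ((4^-1)%:E * (x + y + z) = +oo)%E.
  by move: x y z => [x||] [y||] [z||] //= _ _ _ h; rewrite ?top//; case: h => [|[]].
have [nAy|[a a0 [ha aE]]] := snorm _ bA.
  by rewrite (sum_top _ _ _ nA nB nD (or_introl nAy)) leey.
have [nBy|[b b0 [hb bE]]] := snorm _ bB.
  by rewrite (sum_top _ _ _ nA nB nD (or_intror (or_introl nBy))) leey.
have [nDy|[d d0 [hd dE]]] := snorm _ bD.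
  by rewrite (sum_top _ _ _ nA nB nD (or_intror (or_intror nDy))) leey.
rewrite aE bE dE -!EFinD -EFinM; set m := 4^-1 * _.
have m0 : 0 <= m by rewrite mulr_ge0 ?invr_ge0// !addr_ge0.
apply: sup_sqr_le => // theta; rewrite /= poweR_ge0 /=.
set X := re_op _; have bXt : bounded_op X by exact: bX.
have sX : selfadjoint X by exact: re_op_selfadjoint.
have pXX : positive_op (X \o X).
  by have := positive_adjoint_mul bXt; rewrite adjoint_self.
(* [X] itself has no sign, so the basis diagonalizes the positive operator [X^2]. *)
have [E [basE hE]] := compact_spectral pXX
  (ultra_compact_comp bXt (re_op_compact (expi theta) cT)).
have exE : exists E, @orthonormal_basis R H E by exists E.
have oE := orthonormal_basis_set basE.
have key : (trace_abs_pow q X <= (m `^ r)%:E)%E.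
  apply: trace_selfadjoint_le basE hE _ => // s sE.
  (* The contractions are chosen to match the entries [<A e, U' e>], [<B U' e, e>] and [<D e, e>] of
     the pointwise bound. *)
  have sa := diag_sum_le bA (contraction_id (H := H)) cU' exE oE r1 ha sE.
  have sb := diag_sum_le bB cU' (contraction_id (H := H)) exE oE r1 hb sE.
  have cI := @contraction_id R H; have sd := diag_sum_le bD cI cI exE oE r1 hd sE.
  have sab := minkowski_seq r1 a0 b0 (fun e => rnorm_ge0 _) (fun e => rnorm_ge0 _) sa sb.
  have sabd := minkowski_seq r1 (addr_ge0 a0 b0) d0
    (fun e => addr_ge0 (rnorm_ge0 _) (rnorm_ge0 _)) (fun e => rnorm_ge0 _) sab sd.
  rewrite /m powRM ?invr_ge0//; last by rewrite !addr_ge0.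
  apply: le_trans (ler_wpM2l (powR_ge0 _ _) sabd).
  rewrite mulr_sumr; apply: ler_sum => e _.
  rewrite -powRM ?invr_ge0//; last by rewrite !addr_ge0 ?rnorm_ge0.
  (* [|X e|^q = (|X e|^2)^r], so the pointwise bound is raised to the power [r]. *)
  have -> : q = 2%:R * r by rewrite /r mulrC divfK.
  rewrite powRrM powR_mulrn ?rnorm_ge0//.
  apply: ge0_ler_powR; rewrite ?nnegrE ?sqr_ge0 ?(ltW r0)//.
    by rewrite mulr_ge0 ?invr_ge0// !addr_ge0 ?rnorm_ge0.
  exact: num_radius_bound.
have tX := trace_abs_pow_ge0 bXt q0.
have iq : 0 <= q^-1 by rewrite invr_ge0 ltW.
have h1 : trace_abs_pow q X \in `[0%E, +oo%E] by rewrite in_itv /= tX leey.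
have h2 : (m `^ r)%:E \in `[0%E, +oo%E] by rewrite in_itv /= lee_fin powR_ge0 leey.
apply: le_trans (gt0_ler_poweR iq h1 h2 key) _.
rewrite poweR_EFin -powRrM.
(* The root of order [q] of [m^r] is the square root of [m], as [sup_sqr_le] asks. *)
rewrite (_ : r * q^-1 = 2^-1); last by rewrite /r; field; rewrite gt_eqF.
by rewrite powR12_sqrt.
Qed.

End MainBound.

(** * Elimination of [f] and [g] from the Aluthge transform *)

Section Aluthge.
Context {R : realType} {H : hilbertType R}.
Variables (T : H -> H) (f g : R -> R).
Hypotheses (bT : bounded_op T) (cf : cont_nonneg f) (cg : cont_nonneg g)
  (fg : forall x : R, 0 <= x -> f x * g x = x).
Let P := abs_op T.
Let U := polar_op T.
Let pP : positive_op P := abs_positive bT.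
Let fP := cfc f P.
Let gP := cfc g P.
Let fgP x : fP (gP x) = P x.
Proof. by have /(congr1 (@^~ x)) := cfc_mul_id pP cf cg fg. Qed.
Let gfP x : gP (fP x) = P x.
Proof.
have gf t : 0 <= t -> g t * f t = t by rewrite mulrC; exact: fg.
by have /(congr1 (@^~ x)) := cfc_mul_id pP cg cf gf.
Qed.

(** The outer factors complete the transform to [g(P) f(P) = P] on each side of [U]. *)
Lemma aluthge_conj : gP \o aluthge f g T \o fP = P \o U \o P.
Proof.
apply/funext => x; change (gP (fP (U (gP (fP x)))) = P (U (P x))).
by rewrite !gfP.
Qed.

(** [f(P)] and [g(P)] are selfadjoint, so the adjoint transform is [g(P) U' f(P)], and the outer
    factors complete each side of [U'] to [f(P) g(P) = P]. *)
Lemma adjoint_aluthge_conj : fP \o adjoint (aluthge f g T) \o gP = P \o adjoint U \o P.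
Proof.
have bU : bounded_op U := polar_bounded bT.
have bf := cfc_bounded pP cf; have bg := cfc_bounded pP cg.
have -> : adjoint (aluthge f g T) = gP \o adjoint U \o fP.
  apply: adjoint_unique; first exact: bounded_comp (bounded_comp bf bU) bg.
  move=> x y; rewrite /aluthge /= (cfc_selfadjoint pP cf) (adjointE bU).
  exact: cfc_selfadjoint.
apply/funext => x; change (fP (gP (adjoint U (fP (gP x)))) = P (adjoint U (P x))).
by rewrite !fgP.
Qed.

End Aluthge.
Unset Implicit Arguments.
Set Strict Implicit.

Theorem theorem2p2 (R : realType) (H : hilbertType R)
  (Hsep : separable_hilbert H)
  (p : \bar R) (hp : (2%:E <= p)%E)
  (T : H -> H) (hT : schatten p T)
  (f g : R -> R)
  (f_ge0 : forall x : R, 0 <= x -> 0 <= f x)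
  (g_ge0 : forall x : R, 0 <= x -> 0 <= g x)
  (f_cont : {within `[0, +oo[, continuous f})
  (g_cont : {within `[0, +oo[, continuous g})
  (fg : forall x : R, 0 <= x -> f x * g x = x) :
  let p2 := (p * (2^-1)%:E)%E in
  let fT := cfc f (abs_op T) in
  let gT := cfc g (abs_op T) in
  let T' := aluthge f g T in
  let A := gT \o T' \o fT in
  let B := fT \o adjoint T' \o gT in
  let C := (adjoint T \o T) \+ (T \o adjoint T) in
  (schatten_num_radius p T ^+ 2 <=
   (4^-1)%:E * (schatten_norm p2 A + schatten_norm p2 B
                + schatten_norm p2 C))%E.
Proof.
cbv zeta.
have bT : bounded_op T by move: hT; case: (p) => [q [[]]||].
have cf := within_cont_nonneg f_cont; have cg := within_cont_nonneg g_cont.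
rewrite (aluthge_conj bT cf cg fg) (adjoint_aluthge_conj bT cf cg fg).
(* For [p = +oo] the product of [p] with the positive number [1 / 2] is again [+oo], so all norms
   are operator norms. *)
case: p hp hT => [q||]// hq; last first.
  by rewrite gt0_mulye ?lte_fin ?invr_gt0// => _; exact: opnorm_num_radius_le.
move=> [cT _]; rewrite lee_fin in hq; rewrite -EFinM.
exact: schatten_num_radius_le.
Qed.
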